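(* Let $V:\mathcal{M}^+(\mathbb{R}^d)\to\mathcal{M}^+(\mathbb{R}^d\times\mathbb{R}^d)$, $s:\mathcal{M}^+(\mathbb{R}^d)\to\mathcal{M}^+(\mathbb{R}^d)$ and $c:\mathbb{R}^d\times\mathcal{M}^+(\mathbb{R}^d)\to\mathbb{R}$ satisfy conditions (V), (S), (C) below, and let $\mu_0\in\mathcal{M}^+(\mathbb{R}^d)$ be compactly supported. Then there exists a solution $\mu_\bullet$ of $$\dot\mu_t = V[\mu_t]\oplus c(\cdot,\mu_t)\,\mu_t\oplus s[\mu_t]$$ with initial condition $\mu_0$ in the sense defined below. This solution is Lipschitz continuous with respect to time (as a map $[0,T]\to(\mathcal{M}^+(\mathbb{R}^d),\|\cdot\|_{BL^*})$). Conditions: (V) For all $\mu\in\mathcal{M}^+(\mathbb{R}^d)$, $\pi_1^{\#}V[\mu]=\mu$, where $\pi_1(x,v)=x$; moreover (V1) there is $C_S>0$ with $\sup_{(x,v)\in\operatorname{supp}V[\mu]}|v|\le C_S\bigl(1+\sup_{(x,v)\in\operatorname{supp}V[\mu]}|x|\bigr)$ for all $\mu$; (V2) for every $R>0$ there is $C_F(R)$ such that $\|V[\mu]-V[\nu]\|_{BL^*}\le C_F(R)\|\mu-\nu\|_{BL^*}$ whenever $\mu,\nu$ are supported in $B(0,R)$. (S) (S1) there is $L$ with $\|s[\mu]-s[\nu]\|_{BL^*}\le L\|\mu-\nu\|_{BL^*}$ for all $\mu,\nu\in\mathcal{M}^+(\mathbb{R}^d)$; (S2) there is $R$ with $\operatorname{supp}(s[\mu])\subseteq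 B(0,R)$ for all $\mu$. (C) (C1) there is $C_b>0$ with $|c(x,\mu)|\le C_b$ for all $x,\mu$; (C2) there is $C_L>0$ with $|c(x,\mu)-c(y,\nu)|\le C_L\bigl(|x-y|+\|\mu-\nu\|_{BL^*}\bigr)$ for all $x,y,\mu,\nu$.
   Context: $\mathcal{M}^+(\mathbb{R}^k)$ denotes the finite nonnegative Borel (Radon) measures on $\mathbb{R}^k$. For $f:\mathbb{R}^k\to\mathbb{R}$ let $\|f\|_{BL}=\max(\sup|f|,\ \operatorname{Lip}(f))$ where $\operatorname{Lip}(f)=\sup_{x\ne y}|f(x)-f(y)|/|x-y|$. The flat norm of a signed finite measure $\mu$ on $\mathbb{R}^k$ is $\|\mu\|_{BL^*}=\sup\{\int\psi\,d\mu:\ \|\psi\|_{BL}\le 1\}$ ($k=d$ or $k=2d$). A solution on $[0,T]$ with initial condition $\mu_0$ is a continuous curve $\mu_\bullet:[0,T]\to(\mathcal{M}^+(\mathbb{R}^d),\|\cdot\|_{BL^*})$ such that for all $f\in C_c^\infty(\mathbb{R}^d)$ and all $t\in[0,T]$, $$\int f\,d\mu_t-\int f\,d\mu_0=\int_0^t\!\!\int_{\mathbb{R}^d\times\mathbb{R}^d}\nabla f(x)\cdot v\,dV[\mu_r](x,v)\,dr+\int_0^t\!\!\int f(x)c(x,\mu_r)\,d\mu_r(x)\,dr+\int_0^t\!\!\int f\,ds[\mu_r]\,dr.$$ *)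

(* Defs.v *)
From HB Require Import structures.
From mathcomp Require Import all_boot all_order all_algebra.
From mathcomp Require Import all_classical all_reals all_analysis.
Set Implicit Arguments. Unset Strict Implicit. Unset Printing Implicit Defensive.
Import Order.TTheory GRing.Theory Num.Theory.
Import numFieldNormedType.Exports.
Local Open Scope classical_set_scope.
Local Open Scope ring_scope.

Section Defs.
Variable R : realType.

Definition Rd (d : nat) := g_sigma_algebraType (@open 'rV[R]_d).

Definition enorm d (x : 'rV[R]_d) : R := Num.sqrt (\sum_(i < d) x ord0 i ^+ 2).
Definition eucl_dist d (x y : Rd d) : R := enorm ((x : 'rV[R]_d) - y).
Definition eucl_dist2 d (p q : (Rd d * Rd d)%type) : R :=
  Num.sqrt (eucl_dist p.1 q.1 ^+ 2 + eucl_dist p.2 q.2 ^+ 2).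

Definition Mplus d := {finite_measure set (Rd d) -> \bar R}.
Definition Mplus2 d := {finite_measure set (Rd d * Rd d)%type -> \bar R}.

Definition BL1 (T : Type) (dist : T -> T -> R) (psi : T -> R) :=
  (forall x, `|psi x| <= 1) /\ (forall x y, `|psi x - psi y| <= dist x y).

Definition flat dT (T : measurableType dT) (dist : T -> T -> R)
    (mu nu : {measure set T -> \bar R}) : \bar R :=
  ereal_sup [set ((\int[mu]_x (psi x)%:E) - (\int[nu]_x (psi x)%:E))%E
            | psi in [set psi | BL1 dist psi]].

Definition supp dT (T : measurableType dT) (dist : T -> T -> R)
    (mu : {measure set T -> \bar R}) : set T :=
  [set x | forall r : R, 0 < r -> (0 < mu [set y | (dist x y < r)%R])%E].

Definition ball0 d (r : R) : set (Rd d) := [set x | enorm (x : 'rV[R]_d) < r].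
Definition cball0 d (r : R) : set (Rd d) := [set x | enorm (x : 'rV[R]_d) <= r].

Definition ei d (i : 'I_d) : 'rV[R]_d := delta_mx 0 i.
Fixpoint iter_partial d (s : seq 'I_d) (f : 'rV[R]_d -> R) : 'rV[R]_d -> R :=
  match s with
  | [::] => f
  | i :: s' => fun x => 'D_(ei i) (iter_partial s' f) x
  end.

Definition smooth d (f : 'rV[R]_d -> R) :=
  forall s : seq 'I_d, continuous (iter_partial s f) /\
    (forall (i : 'I_d) (x : 'rV[R]_d), derivable (iter_partial s f) x (ei i)).

Definition test_fun d (f : 'rV[R]_d -> R) :=
  smooth f /\ exists r : R, forall x, r < enorm x -> f x = 0.

Definition grad_dot d (f : 'rV[R]_d -> R) (x v : 'rV[R]_d) : R :=
  \sum_(i < d) 'D_(ei i) f x * v ord0 i.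

Definition cond_V d (V : Mplus d -> Mplus2 d) :=
  [/\ (forall (mu : Mplus d) (A : set (Rd d)), measurable A ->
         V mu [set p | A p.1] = mu A),
      (exists CS : R, 0 < CS /\ forall (mu : Mplus d) (p : (Rd d * Rd d)%type),
         supp (@eucl_dist2 d) (V mu) p ->
         ((enorm (p.2 : 'rV[R]_d))%:E <= CS%:E *
            (1 + ereal_sup [set (enorm (q.1 : 'rV[R]_d))%:E
                           | q in supp (@eucl_dist2 d) (V mu)]))%E)
    & (forall r : R, 0 < r -> exists CF : R, forall mu nu : Mplus d,
         supp (@eucl_dist d) mu `<=` @ball0 d r -> supp (@eucl_dist d) nu `<=` @ball0 d r ->
         (flat (@eucl_dist2 d) (V mu) (V nu) <= CF%:E * flat (@eucl_dist d) mu nu)%E)].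

Definition cond_S d (s : Mplus d -> Mplus d) :=
  (exists L : R, forall mu nu : Mplus d,
      (flat (@eucl_dist d) (s mu) (s nu) <= L%:E * flat (@eucl_dist d) mu nu)%E) /\
  (exists r : R, forall mu : Mplus d, supp (@eucl_dist d) (s mu) `<=` @ball0 d r).

Definition cond_C d (c : 'rV[R]_d -> Mplus d -> R) :=
  (exists Cb : R, 0 < Cb /\ forall x mu, `|c x mu| <= Cb) /\
  (exists CL : R, 0 < CL /\ forall x y (mu nu : Mplus d),
      (`|c x mu - c y nu|%:E <= CL%:E * ((enorm (x - y))%:E + flat (@eucl_dist d) mu nu))%E).

Definition is_solution d (V : Mplus d -> Mplus2 d) (s : Mplus d -> Mplus d)
    (c : 'rV[R]_d -> Mplus d -> R) (T : R) (mu0 : Mplus d) (mu : R -> Mplus d) :=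
  (forall t, 0 <= t <= T -> forall eps : R, 0 < eps -> exists2 delta : R, 0 < delta &
     forall t', 0 <= t' <= T -> `|t - t'| < delta ->
       (flat (@eucl_dist d) (mu t) (mu t') < eps%:E)%E) /\
  (forall f : 'rV[R]_d -> R, test_fun f -> forall t, 0 <= t <= T ->
     \int[mu t]_x f x - \int[mu0]_x f x =
       \int[lebesgue_measure]_(r in [set r : R | 0 <= r <= t])
          (\int[V (mu r)]_p grad_dot f p.1 p.2)
     + \int[lebesgue_measure]_(r in [set r : R | 0 <= r <= t])
          (\int[mu r]_x (f x * c x (mu r)))
     + \int[lebesgue_measure]_(r in [set r : R | 0 <= r <= t])
          (\int[s (mu r)]_x f x)).

Definition lipschitz_in_time d (T : R) (mu : R -> Mplus d) :=
  exists L : R, forall t t', 0 <= t <= T -> 0 <= t' <= T ->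
    (flat (@eucl_dist d) (mu t) (mu t') <= L%:E * `|t - t'|%:E)%E.

End Defs.

(* Main.v *)
Require Import Defs.
From HB Require Import structures.
From mathcomp Require Import all_boot all_order all_algebra.
From mathcomp Require Import all_classical all_reals all_analysis.
From mathcomp Require Import measurable_realfun lra ring.
Import Order.TTheory GRing.Theory Num.Theory.
Import numFieldNormedType.Exports.
Set Implicit Arguments. Unset Strict Implicit. Unset Printing Implicit Defensive.
Local Open Scope classical_set_scope.
Local Open Scope ring_scope.

(** Explicit Euler scheme plus compactness. One step of length [h] from [mu] moves mass along
    [x + h v] under [V mu], weights it by [1 + h c(x, mu)] and adds [h s[mu]]. Over [0, T] the
    supports, the masses and the flat Lipschitz constants in time stay bounded independently
    of [h].

    The measures of bounded mass on a fixed ball are compact for the flat distance. Along an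
    ultrafilter, the masses of Borel sets converge to a finitely additive set function; its
    regularization (inner by closed sets, then outer by open sets) is a measure by
    Caratheodory, the layer-cake formula gives weak convergence, and an Ascoli argument along
    the same ultrafilter makes it uniform over the unit ball of BL.

    The scheme therefore converges along an ultrafilter of steps [h -> 0+], for every [t] at
    once. For a test function [f] it satisfies, with [G] the right-hand side of the equation
    tested against [f],
      [int f dmu_t' - int f dmu_t = (t' - t) G(mu_t) + O((t' - t)^2)]
    up to an error [O(h)]. As [G] is Lipschitz for the flat distance on bounded classes, this
    passes to the limit, so [int f dmu_t] is differentiable with derivative [G(mu_t)]. *)

(** * Regularization of finitely additive set functions *)

(** [V mu] may spread the mass at one point over many velocities, so there are no characteristics to
    follow: the equation sees [V] only through integrals of [grad_dot f]. Two obstacles follow. That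
    integrand is unbounded in the velocity, while the flat distance controls only bounded Lipschitz
    functions; and (V2) holds only for measures in a fixed ball. A support bound uniform in the step
    removes both: by (V1) one step multiplies one plus the radius by at most [1 + h * CS], so a
    discrete Gronwall argument confines all iterates to one ball and one range of speeds.

    Limits of masses taken set by set need regularizing because mass can concentrate: for unit
    masses at points tending to [a] but distinct from [a], the limit gives 0 to the singleton of
    [a].

    Time integrals are never passed to the limit. Only increments between two times are, which
    requires convergence at two times for a common step; the integral form comes back at the end
    from the fundamental theorem of calculus. *)

Section Borel.
Context {R : realType} {d : nat}.
Local Notation B := (g_sigma_algebraType (@open 'rV[R]_d)).

Lemma open_Borel (U : set 'rV[R]_d) : open U -> measurable (U : set B).
Proof. by move=> oU; apply: sub_sigma_algebra. Qed.

Lemma closed_Borel (U : set 'rV[R]_d) : closed U -> measurable (U : set B).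
Proof.
by move=> oU; rewrite -[U]setCK; apply: measurableC; apply: open_Borel; exact: closed_openC.
Qed.
End Borel.

(** Inner parallel set for the sup norm. Being closed, thinnings supply the closed subsets through
    which an open set is measured from inside. *)
Definition thinning {R : realType} {d : nat} (U : set 'rV[R]_d) (e : R) : set 'rV[R]_d :=
  [set x | forall y, `|x - y| < e -> U y].

Lemma thinning_sub {R : realType} {d : nat} (U : set 'rV[R]_d) (e : R) :
  0 < e -> thinning U e `<=` U.
Proof. by move=> e0 x /(_ x); apply; rewrite subrr normr0. Qed.

Lemma closed_thinning {R : realType} {d : nat} (U : set 'rV[R]_d) (e : R) :
  closed (thinning U e).
Proof.
rewrite -[thinning U e]setCK; apply: open_closedC.
rewrite openE => x; rewrite /thinning /= => /existsNP[y] /not_implyP[xy nUy].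
have e0 : 0 < e - `|x - y| by rewrite subr_gt0.
apply/nbhs_ballP; exists (e - `|x - y|) => //= z; rewrite -ball_normE /= distrC => xz.
apply/existsNP; exists y; apply/not_implyP; split => //.
rewrite -[z](subrK x) -addrA (le_lt_trans (ler_normD _ _))//.
by lra.
Qed.

(** The thinnings exhaust an open set locally uniformly. Nearness in the point and in the index
    together is the form that [compact_near_coveringP] consumes. *)
Lemma open_thinning {R : realType} {d : nat} (U : set 'rV[R]_d) x :
  open U -> U x -> \forall x' \near x & m \near \oo, thinning U m.+1%:R^-1 x'.
Proof.
move=> oU Ux.
have /nbhs_ballP[e /= e0 eU] : nbhs x U by exact: open_nbhs_nbhs.
have [N _ HN] : \forall m \near \oo, (m.+1%:R^-1 : R) < e / 2.
  by apply: near_infty_natSinv_lt (PosNum (divr_gt0 e0 (ltr0Sn R 1))).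
exists (ball x (e/2), [set m | (N <= m)%N]).
  by split => /=; [apply: nbhsx_ballx; rewrite divr_gt0 | exists N].
move=> [z m] [/= + Nm] y zy; rewrite -ball_normE /= => xz.
apply: eU; rewrite -ball_normE /= -[x](subrK z) -addrA.
rewrite (le_lt_trans (ler_normD _ _))// [e]splitr ltrD//; exact: lt_trans zy (HN m Nm).
Qed.

Section Regularization.
Context (R : realType) (d : nat).
Local Notation X := 'rV[R]_d.
Local Notation B := (g_sigma_algebraType (@open X)).
Variables (nu : set B -> R) (K : set X).
Hypothesis nu_ge0 : forall A, 0 <= nu A.
Hypothesis nuU : forall A C, measurable A -> measurable C -> A `&` C = set0 ->
  nu (A `|` C) = nu A + nu C.
Hypothesis cK : compact K.
Hypothesis clK : closed K.
Hypothesis nuK : nu (~` K) = 0.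

Let nuID A C : measurable A -> measurable C -> nu A = nu (A `&` C) + nu (A `\` C).
Proof.
move=> mA mC; rewrite -{1}(setUIDK A C) nuU//.
- exact: measurableI.
- exact: measurableD.
- by apply/seteqP; split => // x [[_ Cx] [_ /(_ Cx)]].
Qed.

Let nu_le A C : measurable A -> measurable C -> A `<=` C -> nu A <= nu C.
Proof.
by move=> mA mC AC; rewrite (@nuID C A)// (_ : C `&` A = A) ?lerDl//; exact/setIidPr.
Qed.

Let nu0 : nu set0 = 0.
Proof. by apply/eqP; rewrite eq_le nu_ge0 andbT -nuK nu_le//; apply: measurableC; exact: closed_Borel. Qed.

Let nu_leU A C : measurable A -> measurable C -> nu (A `|` C) <= nu A + nu C.
Proof.
move=> mA mC; rewrite (@nuID (A `|` C) A)//; last exact: measurableU.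
rewrite setUK setDUl setDv set0U lerD2l; apply: nu_le => //.
exact: measurableD.
Qed.

(** Finite additivity says nothing about countable unions. Closed sets meet [K] in compact sets, so
    a supremum over them regains countable subadditivity on open sets; [outer] then extends it to
    all sets. *)
Let inner (U : set X) : \bar R :=
  ereal_sup [set (nu F)%:E | F in [set F | closed F /\ F `<=` U]].

Let outer (A : set X) : \bar R :=
  ereal_inf [set inner U | U in [set U | open U /\ A `<=` U]].

Let inner_ge F U : closed F -> F `<=` U -> ((nu F)%:E <= inner U)%E.
Proof. by move=> cF FU; apply: ereal_sup_ubound; exists F. Qed.

Let inner_ge0 U : (0 <= inner U)%E.
Proof.
apply: le_trans (@inner_ge set0 U closed0 (@sub0set _ _)).
by rewrite lee_fin.
Qed.

Let inner_le U C : measurable (C : set B) -> U `<=` C -> (inner U <= (nu C)%:E)%E.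
Proof.
move=> mC UC; apply: ge_ereal_sup => _ [F [cF FU] <-]; rewrite lee_fin nu_le//.
  exact: closed_Borel.
exact: subset_trans UC.
Qed.

Let inner_mono U U' : U `<=` U' -> (inner U <= inner U')%E.
Proof.
move=> UU; apply: ge_ereal_sup => _ [F [cF FU] <-]; apply: inner_ge => //.
exact: subset_trans UU.
Qed.

Let outer_ge0 A : (0 <= outer A)%E.
Proof. by apply: le_ereal_inf_tmp => _ [U _ <-]; exact: inner_ge0. Qed.

Let outer_open U : open U -> outer U = inner U.
Proof.
move=> oU; apply/eqP; rewrite eq_le; apply/andP; split.
  by apply: ereal_inf_lbound; exists U => //; split.
by apply: le_ereal_inf_tmp => _ [U' [_ UU] <-]; exact: inner_mono.
Qed.

Let outer_le A U : open U -> A `<=` U -> (outer A <= inner U)%E.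
Proof. by move=> oU AU; apply: ereal_inf_lbound; exists U. Qed.

Let outer_fin A : outer A \is a fin_num.
Proof.
rewrite ge0_fin_numE//; apply: (@le_lt_trans _ _ (inner setT)).
  by apply: outer_le => //; exact: openT.
by apply: (@le_lt_trans _ _ (nu setT)%:E); rewrite ?ltry// inner_le.
Qed.

Let outer_mono : {homo outer : A C / A `<=` C >-> (A <= C)%E}.
Proof.
move=> A C AC; apply: le_ereal_inf_tmp => _ [U [oU CU] <-]; apply: outer_le => //.
exact: subset_trans CU.
Qed.

Let outer0 : outer set0 = 0%E.
Proof.
apply/eqP; rewrite eq_le outer_ge0 andbT outer_open; last exact: open0.
by apply: (@le_trans _ _ (nu set0)%:E); [exact: inner_le|rewrite nu0].
Qed.

Let nu_bigsetU (F : nat -> set X) m : (forall i, closed (F i)) ->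
  nu (\big[setU/set0]_(i < m) F i) <= \sum_(i < m) nu (F i).
Proof.
move=> cF; elim: m => [|m IH]; first by rewrite !big_ord0 nu0.
rewrite !big_ord_recr /= (le_trans (@nu_leU _ _ _ _))// ?lerD2r//.
  by apply: bigsetU_measurable => i _; exact: closed_Borel.
exact: closed_Borel.
Qed.

(** This is where compactness of [K] enters: finitely many thinnings already cover the trace of [F]
    on [K], the rest of [F] is null, and finite subadditivity of [nu] suffices. *)
Let inner_bigcup (U : nat -> set X) : (forall i, open (U i)) ->
  (inner (\bigcup_i U i) <= \sum_(i <oo) inner (U i))%E.
Proof.
move=> oU; apply: ge_ereal_sup => _ [F [cF FU] <-].
have cFK : compact (F `&` K) by rewrite setIC; exact: compact_closedI.
move/compact_near_coveringP : cFK.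
move=> /(_ nat \oo (fun m x => exists2 i, (i < m)%N & thinning (U i) m.+1%:R^-1 x)).
case=> [x [/FU[i _ Uix] _]|N _ HN].
  have [[P Q] /= [nP nQ] PQ] := open_thinning (oU i) Uix.
  exists (P, Q `&` [set m | (i < m)%N]) => /=.
    by split => //; apply: filterI => //; exists i.+1.
  by move=> [z m] [Pz [Qm im]]; exists i => //; exact: (PQ (z, m)).
have {HN}HN := HN N (leqnn N).
pose G i := thinning (U i) N.+1%:R^-1.
have GU i : G i `<=` U i by apply: thinning_sub; rewrite invr_gt0.
apply: (@le_trans _ _ (\sum_(i < N) nu (G i))%:E).
  rewrite lee_fin; apply: le_trans (@nu_bigsetU G N _); last by move=> i; exact: closed_thinning.
  rewrite (@nuID F K); [|exact: closed_Borel|exact: closed_Borel].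
  have -> : nu (F `\` K) = 0.
    apply/eqP; rewrite eq_le nu_ge0 andbT -nuK; apply: nu_le; last by move=> x [].
      by apply: measurableD; exact: closed_Borel.
    by apply: measurableC; exact: closed_Borel.
  rewrite addr0; apply: nu_le; first by apply: measurableI; exact: closed_Borel.
    by apply: bigsetU_measurable => i _; apply: closed_Borel; exact: closed_thinning.
  move=> x /HN[i iN Gx]; rewrite -bigcup_mkord; exists i => //.
apply: (@le_trans _ _ (\sum_(i < N) inner (U i))%E).
  rewrite -sumEFin; apply: lee_sum => i _; apply: inner_ge; last exact: GU.
  exact: closed_thinning.
by rewrite -(big_mkord xpredT (fun i => inner (U i))); apply: nneseries_lim_ge => i _ _; exact: inner_ge0.
Qed.

Let outer_sigma : sigma_subadditive outer.
Proof.
move=> A; apply/lee_addgt0Pr => e e0.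
rewrite (le_trans _ (epsilon_trick _ _ _))//; last exact: ltW.
have [U HU] : {U : nat -> set X & forall n, [/\ open (U n), A n `<=` U n &
    (inner (U n) <= outer (A n) + (e / (2 ^ n.+1)%:R)%:E)%E]}.
  apply: (@choice _ _ (fun n U => [/\ open U, A n `<=` U &
    (inner U <= outer (A n) + (e / (2 ^ n.+1)%:R)%:E)%E])) => n.
  have e1 : 0 < e / (2 ^ n.+1)%:R by rewrite divr_gt0// ltr0n expn_gt0.
  have [_ [U [oU AU] <-] H] := lb_ereal_inf_adherent e1 (outer_fin (A n)).
  by exists U; split => //; exact: ltW.
apply: (@le_trans _ _ (inner (\bigcup_i U i))).
  apply: outer_le; first by apply: bigcup_open => i _; case: (HU i).
  by apply: subset_bigcup => i _; case: (HU i).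
apply: le_trans (inner_bigcup _) _; first by move=> i; case: (HU i).
by apply: lee_nneseries => [i _ _|i _]; [exact: inner_ge0|case: (HU i)].
Qed.

HB.instance Definition _ := isOuterMeasure.Build R X outer outer0 outer_ge0 outer_mono outer_sigma.

(** Nearly fill the part of [W] in [U] by a closed [F], then nearly fill [W] minus [F] by a closed
    [F']. The two are disjoint, so additivity of [nu] bounds their total by [inner W]. *)
Let open_cara U : open U -> outer.-caratheodory U.
Proof.
move=> oU; apply: le_caratheodory_measurable => E.
apply: le_ereal_inf_tmp => _ [W [oW EW] <-].
apply: (@le_trans _ _ (outer (W `&` U) + outer (W `&` ~` U))%E).
  by apply: leeD; apply: outer_mono; exact: setSI.
apply/lee_addgt0Pr => e e0.
have e1 : 0 < e / 2 by rewrite divr_gt0.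
have oWU : open (W `&` U) by exact: openI.
have fin V : open V -> inner V \is a fin_num by move=> oV; rewrite -outer_open.
rewrite outer_open//.
have [_ [F [cF FU] <-]] := ub_ereal_sup_adherent e1 (fin _ oWU).
rewrite -/(inner _) => HF.
have oWF : open (W `&` ~` F) by apply: openI => //; exact: closed_openC.
have [_ [F' [cF' FU'] <-]] := ub_ereal_sup_adherent e1 (fin _ oWF).
rewrite -/(inner _) => HF'.
have h1 : (outer (W `&` ~` U) <= inner (W `&` ~` F))%E.
  by apply: outer_le => // x [Wx nUx]; split => // /FU[].
have h2 : ((nu F + nu F')%:E <= inner W)%E.
  rewrite -nuU; [|exact: closed_Borel|exact: closed_Borel|].
    apply: inner_ge; first exact: closedU.
    by move=> x [/FU|/FU'] [].
  by apply/seteqP; split => // x [Fx /FU'[]].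
move: h1 h2 HF HF'.
rewrite -(fineK (fin _ oWU)) -(fineK (fin _ oWF)) -(fineK (fin _ oW)).
rewrite -(fineK (outer_fin (W `&` ~` U))) -!EFinD !lee_fin !lte_fin.
lra.
Qed.

Let cara_Borel (A : set B) : measurable A -> outer.-caratheodory A.
Proof.
move=> /(_ outer.-caratheodory); apply; split; last by move=> U /open_cara.
exact: (sigma_algebra_measurable (caratheodory_type outer)).
Qed.

Let mu (A : set B) : \bar R := outer A.

Let mu_sigma : semi_sigma_additive mu.
Proof.
move=> F mF tF mUF.
have := @caratheodory_measure_sigma_additive R X outer F.
by apply => //; [move=> i; exact: cara_Borel|exact: cara_Borel].
Qed.

HB.instance Definition _ := isMeasure.Build _ B R mu outer0 outer_ge0 mu_sigma.

Let mu_fin : fin_num_fun mu.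
Proof. by move=> A _; exact: outer_fin. Qed.

HB.instance Definition _ := @Measure_isFinite.Build _ B R mu mu_fin.

(** Equal total mass together with an upper bound on open sets is the portmanteau criterion for weak
    convergence, so nothing more is recorded. *)
Lemma regularization : exists m : {finite_measure set B -> \bar R},
  m setT = (nu setT)%:E /\ forall U : set X, open U -> (m U <= (nu U)%:E)%E.
Proof.
exists mu; split => [|U oU]; rewrite /= /mu outer_open//; last 2 first.
- exact: openT.
- by apply: inner_le => //; exact: open_Borel.
apply/eqP; rewrite eq_le inner_le//=; apply: inner_ge => //; exact: closedT.
Qed.
End Regularization.

(** * Euclidean distances and their countable bases *)

Section EuclideanNorm.
Context {R : realType} {d : nat}.
Implicit Types x y : 'rV[R]_d.

Lemma sum_sqr_ge0 x : 0 <= \sum_(i < d) x ord0 i ^+ 2.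
Proof. by apply: sumr_ge0 => i _; exact: sqr_ge0. Qed.

Lemma sqr_enorm x : enorm x ^+ 2 = \sum_(i < d) x ord0 i ^+ 2.
Proof. by rewrite sqr_sqrtr// sum_sqr_ge0. Qed.

Lemma enorm_ge0 x : 0 <= enorm x.
Proof. exact: sqrtr_ge0. Qed.

Lemma coord_le_enorm x i : `|x ord0 i| <= enorm x.
Proof.
rewrite -sqrtr_sqr ler_wsqrtr// (bigD1 i)//= lerDl.
by apply: sumr_ge0 => j _; exact: sqr_ge0.
Qed.

Lemma cauchy_schwarz x y : \sum_(i < d) x ord0 i * y ord0 i <= enorm x * enorm y.
Proof.
have [x0|x0] := eqVneq (enorm x) 0.
  rewrite x0 mul0r big1// => i _.
  by have := coord_le_enorm x i; rewrite x0 normr_le0 => /eqP ->; rewrite mul0r.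
have [y0|y0] := eqVneq (enorm y) 0.
  rewrite y0 mulr0 big1// => i _.
  by have := coord_le_enorm y i; rewrite y0 normr_le0 => /eqP ->; rewrite mulr0.
have xp : 0 < enorm x by rewrite lt_def x0 enorm_ge0.
have yp : 0 < enorm y by rewrite lt_def y0 enorm_ge0.
have : 0 <= \sum_(i < d) (enorm y * x ord0 i - enorm x * y ord0 i) ^+ 2.
  by apply: sumr_ge0 => i _; exact: sqr_ge0.
have E i : (enorm y * x ord0 i - enorm x * y ord0 i) ^+ 2 =
    enorm y ^+ 2 * (x ord0 i ^+ 2) + enorm x ^+ 2 * (y ord0 i ^+ 2) -
    2 * (enorm y * enorm x) * (x ord0 i * y ord0 i) by ring.
under eq_bigr do rewrite E.
rewrite sumrB big_split/= -!mulr_sumr -!sqr_enorm subr_ge0 => H.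
rewrite -(@ler_pM2l _ (2 * (enorm y * enorm x))) ?mulr_gt0//.
by apply: le_trans H _; rewrite le_eqVlt; apply/orP; left; apply/eqP; ring.
Qed.

Lemma enormD x y : enorm (x + y) <= enorm x + enorm y.
Proof.
rewrite -(@ler_pXn2r _ 2)// ?nnegrE ?addr_ge0 ?enorm_ge0//.
rewrite sqr_enorm sqrrD !sqr_enorm.
have E i : (x + y) ord0 i ^+ 2 = x ord0 i ^+ 2 + 2 * (x ord0 i * y ord0 i) + y ord0 i ^+ 2.
  by rewrite mxE; ring.
under eq_bigr do rewrite E.
rewrite !big_split/= -mulr_sumr; have := cauchy_schwarz x y; lra.
Qed.

Lemma enormN x : enorm (- x) = enorm x.
Proof. by rewrite /enorm; under eq_bigr do rewrite mxE sqrrN. Qed.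

Lemma enormZ a x : enorm (a *: x) = `|a| * enorm x.
Proof.
rewrite /enorm; under eq_bigr do rewrite mxE exprMn.
by rewrite -mulr_sumr sqrtrM ?sqr_ge0// sqrtr_sqr.
Qed.

Lemma enorm0 : enorm (0 : 'rV[R]_d) = 0.
Proof. by rewrite -(scale0r 0) enormZ normr0 mul0r. Qed.

Lemma enormB x y : enorm (x - y) = enorm (y - x).
Proof. by rewrite -enormN opprB. Qed.

Lemma enorm_lip x y : `|enorm x - enorm y| <= enorm (x - y).
Proof.
rewrite ler_norml; apply/andP; split.
  by have := enormD (y - x) x; rewrite subrK enormB; lra.
by have := enormD (x - y) y; rewrite subrK; lra.
Qed.

Lemma enorm_le_sum x : enorm x <= \sum_(i < d) `|x ord0 i|.
Proof.
rewrite -[leRHS]ger0_norm ?sumr_ge0// -sqrtr_sqr ler_wsqrtr//.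
have : forall (n : nat) (a : 'I_n -> R), \sum_(i < n) a i ^+ 2 <= (\sum_(i < n) `|a i|) ^+ 2.
  elim=> [|n IH] a; first by rewrite !big_ord0 expr0n.
  rewrite !big_ord_recr/= sqrrD real_normK ?num_real// lerD2r.
  apply: (le_trans (IH _)); rewrite lerDl mulrn_wge0// mulr_ge0// sumr_ge0//.
exact.
Qed.

Lemma mx_norm_le_enorm x : `|x| <= enorm x.
Proof.
have [->|/mx_norm_neq0[[i j] /= e]] := eqVneq `|x| 0; first exact: enorm_ge0.
by rewrite [`|x|]e (ord1 i) coord_le_enorm.
Qed.

Lemma enorm_le_mx_norm x : enorm x <= d%:R * `|x|.
Proof.
apply: (le_trans (enorm_le_sum x)).
rewrite -[X in X%:R * _]card_ord -sum1_card natr_sum mulr_suml.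
apply: ler_sum => i _; rewrite mul1r.
rewrite [leRHS]mx_normrE; exact: (le_bigmax _ (fun ij => `|x ij.1 ij.2|) (ord0, i)).
Qed.

Lemma enorm_lip_continuous (f : 'rV[R]_d -> R) k :
  (forall x y, `|f x - f y| <= k * enorm (x - y)) -> continuous f.
Proof.
move=> kf x; apply/(@cvgrPdist_lt _ _ _ _ (nbhs_filter x)) => e e0; apply/nbhs_ballP.
(* The added ones keep the divisor positive: [k] has any sign and [d] may be 0. *)
have k0 : 0 < (`|k| + 1) * (d%:R + 1) by rewrite mulr_gt0.
exists (e / ((`|k| + 1) * (d%:R + 1))) => /=; first by rewrite divr_gt0.
move=> y; rewrite -ball_normE/= ltr_pdivlMr// => xy.
apply: le_lt_trans (kf _ _) (le_lt_trans _ xy).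
have := enorm_le_mx_norm (x - y); have := enorm_ge0 (x - y); have := ler_norm k.
have := normr_ge0 (x - y); have : 0 <= d%:R :> R by []; have := normr_ge0 k.
set K := `|k|; set D := d%:R; set N := `|x - y|; set E := enorm _ => K0 D0 N0 kK E0 ED.
apply: (@le_trans _ _ (K * E)); first exact: ler_wpM2r.
apply: (@le_trans _ _ (K * (D * N))); first exact: ler_wpM2l.
have := mulr_ge0 K0 N0; have := mulr_ge0 D0 N0; lra.
Qed.

Lemma enorm_continuous : continuous (@enorm R d).
Proof. by apply: (@enorm_lip_continuous _ 1) => x y; rewrite mul1r enorm_lip. Qed.

Lemma closed_cball (r : R) : closed [set x : 'rV[R]_d | enorm x <= r].
Proof.
apply: (@closed_comp _ _ (@enorm R d) [set y | y <= r]); last exact: closed_le.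
by move=> x _; exact: enorm_continuous.
Qed.

Lemma compact_cball (r : R) : compact [set x : 'rV[R]_d | enorm x <= r].
Proof.
apply: bounded_closed_compact; last exact: closed_cball.
exists r; split; first exact: num_real.
move=> M rM x /= xr; rewrite (le_trans (mx_norm_le_enorm _))// (le_trans xr)//; exact: ltW.
Qed.

End EuclideanNorm.

Section Dist.
Context {R : realType} {d : nat}.
Implicit Types x y z : Rd R d.
Implicit Types p q r : (Rd R d * Rd R d)%type.

Lemma eucl_dist_triangle x y z : eucl_dist x z <= eucl_dist x y + eucl_dist y z.
Proof.
rewrite /eucl_dist (_ : (x : 'rV_d) - z = ((x : 'rV_d) - y) + ((y : 'rV_d) - z)) ?enormD//.
by rewrite addrA subrK.
Qed.

Lemma eucl_distC x y : eucl_dist x y = eucl_dist y x.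
Proof. exact: enormB. Qed.

Lemma eucl_dist_ge0 x y : 0 <= eucl_dist x y.
Proof. exact: enorm_ge0. Qed.

Lemma eucl_dist2_ge0 p q : 0 <= eucl_dist2 p q.
Proof. exact: sqrtr_ge0. Qed.

Lemma eucl_dist_fst_le p q : eucl_dist p.1 q.1 <= eucl_dist2 p q.
Proof.
rewrite -[leLHS]ger0_norm ?eucl_dist_ge0// -sqrtr_sqr ler_wsqrtr//.
by rewrite lerDl sqr_ge0.
Qed.

Lemma eucl_dist_snd_le p q : eucl_dist p.2 q.2 <= eucl_dist2 p q.
Proof.
rewrite -[leLHS]ger0_norm ?eucl_dist_ge0// -sqrtr_sqr ler_wsqrtr//.
by rewrite lerDr sqr_ge0.
Qed.

Lemma eucl_dist2_le p q : eucl_dist2 p q <= eucl_dist p.1 q.1 + eucl_dist p.2 q.2.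
Proof.
rewrite -[leRHS]ger0_norm ?addr_ge0 ?eucl_dist_ge0// -sqrtr_sqr ler_wsqrtr//.
rewrite sqrrD lerD2r lerDl mulrn_wge0// mulr_ge0// eucl_dist_ge0//.
Qed.

(** The product distance is the Euclidean norm of a pair of distances, so this is [enormD] in the
    plane followed by monotonicity in each coordinate. *)
Lemma eucl_dist2_triangle p q r : eucl_dist2 p r <= eucl_dist2 p q + eucl_dist2 q r.
Proof.
have [a b] := (eucl_dist_triangle p.1 q.1 r.1, eucl_dist_triangle p.2 q.2 r.2).
have := (eucl_dist_ge0 p.1 r.1, eucl_dist_ge0 p.2 r.2).
pose u := \row_(i < 2) (if i == ord0 then eucl_dist p.1 q.1 else eucl_dist p.2 q.2).
pose v := \row_(i < 2) (if i == ord0 then eucl_dist q.1 r.1 else eucl_dist q.2 r.2).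
have -> : eucl_dist2 p q = enorm u by rewrite /enorm !big_ord_recr/= big_ord0 add0r !mxE.
have -> : eucl_dist2 q r = enorm v by rewrite /enorm !big_ord_recr/= big_ord0 add0r !mxE.
move=> [p1 p2]; apply: le_trans (enormD u v).
rewrite /enorm !big_ord_recr/= big_ord0 add0r !mxE /= ler_wsqrtr//.
by apply: lerD; rewrite ler_sqr// nnegrE (le_trans _ a, le_trans _ b).
Qed.

End Dist.

(* Covers both [Rd] with its Borel sets and [Rd * Rd] with the product sigma-algebra: the
   countable basis [B] is what makes Lipschitz functions measurable for the latter. *)
Record measurable_base {R : realType} dT (T : measurableType dT) (dist : T -> T -> R)
    (B : nat -> set T) : Prop := MeasurableBase {
  mb_ge0 : forall x y, 0 <= dist x y ;
  mb_triangle : forall x y z, dist x z <= dist x y + dist y z ;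
  mb_measurable : forall n, measurable (B n) ;
  mb_base : forall x (r : R), 0 < r -> exists2 n, B n x & B n `<=` [set y | dist x y < r] }.

Section MeasurableBase.
Context {R : realType} dT (T : measurableType dT) (dist : T -> T -> R) (B : nat -> set T).
Hypothesis mB : measurable_base dist B.

Lemma base_open_measurable (O : set T) :
  (forall x, O x -> exists2 r : R, 0 < r & [set y | dist x y < r] `<=` O) -> measurable O.
Proof.
move=> oO; rewrite (_ : O = \bigcup_(n in [set n | B n `<=` O]) B n).
  by apply: bigcup_measurable => n _; exact: (mb_measurable mB).
apply/seteqP; split => [x Ox|x [n /= BO /BO]//].
have [r r0 rO] := oO x Ox; have [n Bx Bn] := mb_base mB x r0.
by exists n => //; exact: subset_trans rO.
Qed.

Lemma base_ball_measurable x r : measurable [set y | dist x y < r].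
Proof.
apply: base_open_measurable => y /= xy; exists (r - dist x y); first by rewrite subr_gt0.
by move=> z /=; have := mb_triangle mB x y z; lra.
Qed.

Lemma base_lip_measurable (f : T -> R) k :
  (forall x y, `|f x - f y| <= k * dist x y) -> measurable_fun setT f.
Proof.
move=> kf; apply: (measurability _ (RGenOInfty.measurableE R)) => //.
move=> _ [_ [a ->] <-]; rewrite setTI.
apply: base_open_measurable => x; rewrite /= in_itv/= andbT => ax.
have e0 : 0 < f x - a by rewrite subr_gt0.
have K0 : 0 < `|k| + 1 by have := normr_ge0 k; lra.
exists ((f x - a) / (`|k| + 1)); first by rewrite divr_gt0.
move=> y /=; rewrite ltr_pdivlMr// in_itv/= andbT => xy.
have := kf x y; rewrite ler_norml => /andP[_].
have := ler_wpM2r (mb_ge0 mB x y) (ler_norm k); have := mb_ge0 mB x y.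
lra.
Qed.

(** Lindelof argument: a point off the support lies in a null set of the base, and the base is
    countable. *)
Lemma supp_null (mu : {measure set T -> \bar R}) (A : set T) : measurable A ->
  A `&` supp dist mu = set0 -> mu A = 0%E.
Proof.
move=> mA A0; apply: measure_negligible => //.
apply: (@negligibleS _ _ _ _ (\bigcup_(n in [set n | mu (B n) = 0%E]) B n) A).
  move=> x Ax; have : ~ supp dist mu x by move=> sx; have : set0 x by rewrite -A0.
  move=> /existsNP[r /not_implyP[r0 /negP]]; rewrite -leNgt => mu0.
  have [n Bx Bn] := mb_base mB x r0; exists n => //=.
  apply/eqP; rewrite eq_le measure_ge0 andbT (le_trans _ mu0)// le_measure// inE.
    exact: (mb_measurable mB).
  exact: base_ball_measurable.
rewrite (_ : bigcup _ _ = \bigcup_n (if asbool (mu (B n) = 0%E) then B n else set0)).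
  apply: negligible_bigcup => n; case: asboolP => H; last exact: negligible_set0.
  by exists (B n); split => //; exact: (mb_measurable mB).
apply/seteqP; split => x [n] H1 H2; exists n => //; last by move: H2; case: asboolP.
  by case: asboolP.
by move: H2; case: asboolP.
Qed.

Lemma null_supp (mu : {measure set T -> \bar R}) (A : set T) x : measurable A -> mu A = 0%E ->
  (exists2 r : R, 0 < r & [set y | dist x y < r] `<=` A) -> ~ supp dist mu x.
Proof.
move=> mA A0 [r r0 rA] /(_ r r0); apply/negP; rewrite -leNgt -A0 le_measure// inE//.
exact: base_ball_measurable.
Qed.

End MeasurableBase.

(** * Countable bases of rational balls and of their products *)

Section EuclideanBase.
Context {R : realType} {d : nat}.

(** An integer that encodes no pair gives the empty set, which is harmless in a base. *)
Definition rat_ball (n : nat) : set (Rd R d) :=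
  if @unpickle ('rV[rat]_d * nat)%type n is Some (q, k)
  then [set x | enorm ((x : 'rV[R]_d) - map_mx ratr q) < k.+1%:R^-1] else set0.

Lemma rat_rV_dense (x : 'rV[R]_d) (e : R) : 0 < e ->
  exists q : 'rV[rat]_d, enorm (x - map_mx ratr q) < e.
Proof.
move=> e0; have h i : {q : rat | ratr q \in `]x ord0 i, x ord0 i + e / (d%:R + 1)[}.
  by apply: cid; apply: rat_in_itvoo; rewrite ltrDl divr_gt0// ltr_wpDl.
exists (\row_i projT1 (h i)).
apply: le_lt_trans (enorm_le_sum _) _.
apply: (@le_lt_trans _ _ (\sum_(i < d) e / (d%:R + 1))).
  apply: ler_sum => i _; rewrite !mxE; case: (h i) => q /=; rewrite in_itv/= => /andP[h1 h2].
  by rewrite ler_norml; apply/andP; split; lra.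
rewrite sumr_const card_ord -[X in X < _]mulr_natr -mulrA -[ltRHS]mulr1 ltr_pM2l// mulrC.
by rewrite ltr_pdivrMr ?ltr_wpDl// mul1r ltrDl.
Qed.

Lemma measurable_base_Rd : measurable_base (@eucl_dist R d) rat_ball.
Proof.
split.
- exact: eucl_dist_ge0.
- exact: eucl_dist_triangle.
- move=> n; rewrite /rat_ball; case: unpickle => [[q k]|]//.
  apply: open_Borel.
  apply: (@open_comp _ _ (fun x : 'rV[R]_d => enorm (x - map_mx ratr q)) [set y | y < k.+1%:R^-1]); last exact: open_lt.
  move=> x _; apply: (@enorm_lip_continuous _ _ _ 1) => y z.
  by rewrite mul1r (le_trans (enorm_lip _ _))// opprB addrA subrK.
- move=> x r r0.
  have [k _ Hk] : \forall m \near \oo, (m.+1%:R^-1 : R) < r / 2.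
    by apply: near_infty_natSinv_lt (PosNum (divr_gt0 r0 (ltr0Sn R 1))).
  have k0 : 0 < k.+1%:R^-1 :> R by rewrite invr_gt0.
  have [q xq] := rat_rV_dense x k0.
  exists (pickle (q, k)); rewrite /rat_ball pickleK//= => y /= yq.
  rewrite /eucl_dist -[(x : 'rV_d)](subrK (map_mx ratr q)) -addrA.
  apply: (le_lt_trans (enormD _ _)); rewrite [r]splitr ltrD//.
    by apply: lt_trans xq (Hk k _) => /=.
  by rewrite enormB; apply: lt_trans yq (Hk k _) => /=.
Qed.

Definition rat_box (n : nat) : set (Rd R d * Rd R d)%type :=
  if @unpickle (nat * nat)%type n is Some (k, l) then rat_ball k `*` rat_ball l else set0.

Lemma measurable_base_Rd2 : measurable_base (@eucl_dist2 R d) rat_box.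
Proof.
split.
- exact: eucl_dist2_ge0.
- exact: eucl_dist2_triangle.
- move=> n; rewrite /rat_box; case: unpickle => [[k l]|]//.
  by apply: measurableX; exact: (mb_measurable measurable_base_Rd).
- move=> [x y] r r0; have r2 : 0 < r / 2 by rewrite divr_gt0.
  have [k kx Hk] := mb_base measurable_base_Rd x r2.
  have [l ly Hl] := mb_base measurable_base_Rd y r2.
  exists (pickle (k, l)); rewrite /rat_box pickleK//= => -[x' y'] [/= /Hk /= h1 /Hl /= h2].
  apply: le_lt_trans (eucl_dist2_le _ _) _ => /=; lra.
Qed.

End EuclideanBase.

(** * Bounded measurable functions and the flat distance *)

Notation mass mu := (fine (mu setT)).

Lemma RintegralD3 dT (T : measurableType dT) (R : realType) (mu : {measure set T -> \bar R})
    (D : set T) (f g h : T -> R) : measurable D -> mu.-integrable D (EFin \o f) ->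
  mu.-integrable D (EFin \o g) -> mu.-integrable D (EFin \o h) ->
  \int[mu]_(x in D) (f x + g x + h x) =
    \int[mu]_(x in D) f x + \int[mu]_(x in D) g x + \int[mu]_(x in D) h x.
Proof.
move=> mD mf mg mh; rewrite RintegralD//; last exact: (integrableD mD mf mg).
by rewrite RintegralD.
Qed.

Section BoundedMeasurable.
Context {R : realType} dT (T : measurableType dT).
Implicit Types (f g : T -> R) (mu : {finite_measure set T -> \bar R}).

Definition bdmeas f := measurable_fun setT f /\ exists M, forall x, `|f x| <= M.

Lemma bdmeas_cst (a : R) : bdmeas (cst a).
Proof. by split; [exact: measurable_cst | exists `|a|]. Qed.

Lemma bdmeasD f g : bdmeas f -> bdmeas g -> bdmeas (fun x => f x + g x).
Proof.
move=> [mf [M fM]] [mg [N gN]]; split; first exact: measurable_funD.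
by exists (M + N) => x; rewrite (le_trans (ler_normD _ _))// lerD.
Qed.

Lemma bdmeasB f g : bdmeas f -> bdmeas g -> bdmeas (fun x => f x - g x).
Proof.
move=> [mf [M fM]] [mg [N gN]]; split; first exact: measurable_funB.
by exists (M + N) => x; rewrite (le_trans (ler_normB _ _))// lerD.
Qed.

Lemma bdmeasM f g : bdmeas f -> bdmeas g -> bdmeas (fun x => f x * g x).
Proof.
move=> [mf [M fM]] [mg [N gN]]; split; first exact: measurable_funM.
by exists (M * N) => x; rewrite normrM ler_pM.
Qed.

Lemma bdmeasZ a f : bdmeas f -> bdmeas (fun x => a * f x).
Proof. exact: (bdmeasM (bdmeas_cst a)). Qed.

Lemma bdmeas_sum (I : Type) (r : seq I) (F : I -> T -> R) :
  (forall i, bdmeas (F i)) -> bdmeas (fun x => \sum_(i <- r) F i x).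
Proof.
move=> bF; elim: r => [|i r IH].
  by under [X in bdmeas X]funext do rewrite big_nil; exact: bdmeas_cst.
under [X in bdmeas X]funext do rewrite big_cons.
exact: bdmeasD.
Qed.

Lemma bdmeas_comp dU (U : measurableType dU) (h : U -> T) f :
  measurable_fun setT h -> bdmeas f -> measurable_fun setT (f \o h) /\ exists M, forall x, `|f (h x)| <= M.
Proof.
move=> mh [mf [M fM]]; split; last by exists M.
exact: measurableT_comp.
Qed.

Lemma bdmeas_integrable mu f : bdmeas f -> mu.-integrable setT (EFin \o f).
Proof.
move=> [mf [M fM]]; apply: measurable_bounded_integrable => //.
  by rewrite ltey_eq fin_num_measure.
exists M; split; first exact: num_real.
by move=> N MN x _ /=; rewrite (le_trans (fM x))// ltW.
Qed.

Lemma mass_ge0 mu : 0 <= mass mu.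
Proof. by rewrite fine_ge0. Qed.

Lemma Rintegral_cstT mu (a : R) : \int[mu]_x a = a * mass mu.
Proof. by rewrite Rintegral_cst. Qed.

Lemma RintegralDT mu f g : bdmeas f -> bdmeas g ->
  \int[mu]_x (f x + g x) = \int[mu]_x f x + \int[mu]_x g x.
Proof. by move=> bf bg; rewrite RintegralD//; exact: bdmeas_integrable. Qed.

Lemma RintegralBT mu f g : bdmeas f -> bdmeas g ->
  \int[mu]_x (f x - g x) = \int[mu]_x f x - \int[mu]_x g x.
Proof. by move=> bf bg; rewrite RintegralB//; exact: bdmeas_integrable. Qed.

Lemma RintegralZT mu f a : bdmeas f -> \int[mu]_x (a * f x) = a * \int[mu]_x f x.
Proof. by move=> bf; rewrite RintegralZl//; exact: bdmeas_integrable. Qed.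

Lemma le_RintegralT mu f g : bdmeas f -> bdmeas g -> (forall x, f x <= g x) ->
  \int[mu]_x f x <= \int[mu]_x g x.
Proof.
by move=> bf bg fg; apply: le_Rintegral => //; exact: bdmeas_integrable.
Qed.

Lemma Rintegral_norm_le mu f M : bdmeas f -> (forall x, `|f x| <= M) ->
  `|\int[mu]_x f x| <= M * mass mu.
Proof.
move=> bf fM; rewrite ler_norml -mulNr -!Rintegral_cstT.
by apply/andP; split; apply: le_RintegralT => //; try exact: bdmeas_cst;
  move=> x; have := fM x; rewrite ler_norml => /andP[].
Qed.

Lemma eq_Rintegral_ae mu f g (A : set T) : measurable A -> mu (~` A) = 0%E ->
  measurable_fun setT f -> measurable_fun setT g -> (forall x, A x -> f x = g x) ->
  \int[mu]_x f x = \int[mu]_x g x.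
Proof.
move=> mA A0 mf mg fg; congr fine; apply: ae_eq_integral => //; do ?exact/measurable_EFinP.
exists (~` A); split => //; first exact: measurableC.
by move=> x /= H Ax; apply: H => _; rewrite fg.
Qed.

Lemma Rintegral_dist_le mu f g (A : set T) e : measurable A -> mu (~` A) = 0%E ->
  bdmeas f -> bdmeas g -> 0 <= e -> (forall x, A x -> `|f x - g x| <= e) ->
  `|\int[mu]_x f x - \int[mu]_x g x| <= e * mass mu.
Proof.
move=> mA A0 bf bg e0 fg; rewrite -RintegralBT//.
have b1 : bdmeas (\1_A : T -> R).
  split; first exact: measurable_indic.
  by exists 1 => x; rewrite indicE; case: (x \in A); rewrite ?normr1 ?normr0.
have bfg := bdmeasB bf bg.
rewrite (@eq_Rintegral_ae _ _ (fun x => (f x - g x) * \1_A x) A)//.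
- apply: Rintegral_norm_le; first exact: bdmeasM.
  move=> x; rewrite indicE; have [/set_mem Ax|] := boolP (x \in A).
    by rewrite mulr1 fg.
  by rewrite mulr0 normr0.
- by case: bfg.
- by case: (bdmeasM bfg b1).
- by move=> x Ax; rewrite indicE mem_set// mulr1.
Qed.

End BoundedMeasurable.

(** * Layer-cake sums and positive linear functionals *)

Lemma sum_indic_bounds {R : realType} (n : nat) (s : R) : 0 <= s ->
  Num.min s n%:R <= \sum_(j < n) (j%:R < s)%R%:R <= Num.min (s + 1) n%:R.
Proof.
move=> s0; elim: n => [|n /andP[IH1 IH2]]; first by rewrite big_ord0; apply/andP; split;
    [rewrite ge_min lexx orbT|rewrite le_min lexx andbT; lra].
rewrite big_ord_recr/= -(natr1 n); set S := \sum_(j < n) _ in IH1 IH2 *.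
move: IH1 IH2; rewrite !le_min !ge_min => /orP IH1 /andP[IH2 IH3].
have [ns|ns] := ltP n%:R s => /=; rewrite ?addr0.
  apply/andP; split; last by apply/andP; split; lra.
  by apply/orP; right; case: IH1 => ?; lra.
apply/andP; split; last by apply/andP; split; lra.
by apply/orP; left; case: IH1 => ?; lra.
Qed.

Section LayerSum.
Context {R : realType} dT (T : measurableType dT).
Implicit Types (g : T -> R) (mu : {finite_measure set T -> \bar R}).

(** Riemann sum of the layer-cake formula: the inner sum counts the levels below [N.+1%:R * g x]. It
    reduces integrals to masses of superlevel sets, which the strict inequality makes open when [g]
    is continuous. *)
Definition layer_sum g (N : nat) (x : T) : R :=
  N.+1%:R^-1 * \sum_(j < N.+1) \1_[set y | j%:R < N.+1%:R * g y] x.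

Lemma layer_sum_bounds g N x : (forall x, 0 <= g x <= 1) ->
  g x <= layer_sum g N x <= g x + N.+1%:R^-1.
Proof.
move=> g01; have /andP[g0 g1] := g01 x; have N0 : 0 < N.+1%:R :> R by [].
have -> : layer_sum g N x = N.+1%:R^-1 * \sum_(j < N.+1) (j%:R < N.+1%:R * g x)%R%:R.
  congr (_ * _); apply: eq_bigr => j _; rewrite indicE; congr (nat_of_bool _)%:R.
  by apply/idP/idP => [/set_mem//|H]; rewrite inE.
have := @sum_indic_bounds _ N.+1 _ (mulr_ge0 (ltW N0) g0).
move=> /andP[h1 h2]; apply/andP; split.
  by rewrite -ler_pdivrMl ?invr_gt0// invrK (le_trans _ h1)// le_min lexx/= ler_piMr// ltW.
rewrite ler_pdivrMl// mulrDr divff ?lt0r_neq0//; apply: le_trans h2 _.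
by rewrite ge_min lexx.
Qed.

Lemma measurable_superlevel g N (j : 'I_N.+1) : measurable_fun setT g ->
  measurable [set y | j%:R < N.+1%:R * g y].
Proof.
move=> mg; rewrite -[X in measurable X]setTI.
have mNg : measurable_fun setT (fun y => N.+1%:R * g y) by exact: measurable_funM.
rewrite (_ : [set y | _] = (fun y => N.+1%:R * g y) @^-1` `]j%:R, +oo[%classic).
  by apply: mNg => //; exact: measurable_itv.
by apply/seteqP; split => y /=; rewrite in_itv/= andbT.
Qed.

Lemma bdmeas_indic (A : set T) : measurable A -> bdmeas (\1_A : T -> R).
Proof.
move=> mA; split; first exact: measurable_indic.
by exists 1 => x; rewrite indicE; case: (_ \in _); rewrite ?normr1 ?normr0.
Qed.

Lemma bdmeas_layer_sum g N : measurable_fun setT g -> bdmeas (layer_sum g N).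
Proof.
move=> mg; apply: bdmeasZ.
by apply: bdmeas_sum => j; apply: bdmeas_indic; exact: measurable_superlevel.
Qed.

Definition positive_linear (L : (T -> R) -> R) :=
  [/\ forall f g, bdmeas f -> bdmeas g -> L (fun x => f x + g x) = L f + L g,
      forall a f, bdmeas f -> L (fun x => a * f x) = a * L f &
      forall f g, bdmeas f -> bdmeas g -> (forall x, f x <= g x) -> L f <= L g].

Lemma positive_linear_Rintegral mu : positive_linear (fun f => \int[mu]_x f x).
Proof.
split=> [f g|a f|f g]; [exact: RintegralDT|exact: RintegralZT|exact: le_RintegralT].
Qed.

Lemma positive_linear_layer_sum L g N : positive_linear L -> measurable_fun setT g ->
  L (layer_sum g N) = N.+1%:R^-1 * \sum_(j < N.+1) L (\1_[set y | j%:R < N.+1%:R * g y]).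
Proof.
move=> [LD LZ _] mg; have bA (j : 'I_N.+1) := bdmeas_indic (measurable_superlevel j mg).
rewrite [LHS]LZ; last exact: bdmeas_sum.
congr (_ * _).
have : forall s : seq 'I_N.+1, L (fun x => \sum_(j <- s) \1_[set y | j%:R < N.+1%:R * g y] x) =
    \sum_(j <- s) L (\1_[set y | j%:R < N.+1%:R * g y]); last exact.
elim=> [|j s IH].
  rewrite big_nil; under [X in L X]funext do rewrite big_nil -(mul0r 0).
  by rewrite LZ ?mul0r//; exact: bdmeas_cst.
under [X in L X]funext do rewrite big_cons.
by rewrite big_cons LD// ?IH//; exact: bdmeas_sum.
Qed.

Lemma Rintegral_indicT mu (A : set T) : measurable A -> \int[mu]_x (\1_A x : R) = fine (mu A).
Proof. by move=> mA; rewrite /Rintegral integral_indic// setIT. Qed.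

Lemma Rintegral_layer_sum mu g N : measurable_fun setT g -> \int[mu]_x layer_sum g N x =
  N.+1%:R^-1 * \sum_(j < N.+1) fine (mu [set y | j%:R < N.+1%:R * g y]).
Proof.
move=> mg; rewrite (positive_linear_layer_sum _ (positive_linear_Rintegral mu))//.
congr (_ * _); apply: eq_bigr => j _; rewrite Rintegral_indicT//; exact: measurable_superlevel.
Qed.

(** No continuity of the functionals is assumed. Positivity alone places the value on the layer sum
    within [N.+1%:R^-1 * L (cst 1)] of the value on [g], and layer sums are combinations of
    indicators. Changes of variables can thus be checked on indicators. *)
Lemma eq_positive_linear L L' : positive_linear L -> positive_linear L' ->
  (forall A, measurable A -> L (\1_A) = L' (\1_A)) -> forall f, bdmeas f -> L f = L' f.
Proof.
move=> pL pL' LL'.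
have bc (a : R) := @bdmeas_cst _ _ T a.
have key K : positive_linear K -> forall g N, measurable_fun setT g -> (forall x, 0 <= g x <= 1) ->
    K g <= K (layer_sum g N) <= K g + N.+1%:R^-1 * K (cst 1).
  move=> [KD KZ Kle] g N mg g01; have bS := bdmeas_layer_sum N mg.
  have bg : bdmeas g.
    by split => //; exists 1 => x; have /andP[g0 g1] := g01 x; rewrite ger0_norm.
  apply/andP; split.
    by apply: Kle => // x; case/andP: (layer_sum_bounds N x g01).
  have b1 : bdmeas (fun x : T => N.+1%:R^-1 * (cst 1 x : R)) by exact: bdmeasZ.
  rewrite -KZ// -KD//; apply: Kle => //; first exact: bdmeasD.
  by move=> x /=; rewrite mulr1; case/andP: (layer_sum_bounds N x g01).
have L1 : L (cst 1) = L' (cst 1) by have := LL' setT measurableT; rewrite indicT.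
have L10 : 0 <= L (cst 1).
  case: pL => _ LZ Lle; have -> : 0 = L (fun x => 0 * (cst 1 x)) by rewrite LZ// mul0r.
  by apply: Lle => // [|x]; [exact: bdmeasZ|rewrite mul0r].
have eq01 g : measurable_fun setT g -> (forall x, 0 <= g x <= 1) -> L g = L' g.
  move=> mg g01; apply/eqP; rewrite -subr_eq0 -normr_le0; apply/ler_addgt0Pr => e e0.
  rewrite add0r.
  have [N _ HN] : \forall n \near \oo, (n.+1%:R^-1 : R) < e / (L (cst 1) + 1).
    have e2 : 0 < e / (L (cst 1) + 1) by rewrite divr_gt0// ltr_wpDl.
    by apply: near_infty_natSinv_lt (PosNum e2).
  have {HN}HN := HN N (leqnn N).
  have /andP[h1 h2] := key _ pL g N mg g01; have /andP[h3 h4] := key _ pL' g N mg g01.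
  have E : L (layer_sum g N) = L' (layer_sum g N).
    rewrite !positive_linear_layer_sum//; congr (_ * _).
    by apply: eq_bigr => j _; rewrite LL'//; exact: measurable_superlevel.
  have h5 : N.+1%:R^-1 * L (cst 1) <= e.
    apply: (@le_trans _ _ (e / (L (cst 1) + 1) * (L (cst 1) + 1))).
      by apply: ler_pM; rewrite ?invr_ge0 ?lerDl// ltW.
    by rewrite divfK// gt_eqF// ltr_wpDl.
  move: h2 h4 h5; rewrite -L1; move: (_ * L (cst 1)) => Y ? ? ?.
  by rewrite ler_norml; apply/andP; split; lra.
(* An affine map with nonzero slope brings [f] into [0, 1]. *)
move=> f [mf [M fM]]; pose M' := `|M| + 1.
have M0 : 0 < M' by rewrite ltr_wpDl.
pose g x := (2 * M')^-1 * (f x + M').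
have bf : bdmeas f by split => //; exists M.
have fD : f = (fun x => 2 * M' * g x + (- M') * cst 1 x).
  by apply/funext => x /=; rewrite /g mulrA divff ?mul1r ?mulr1 ?addrK// mulf_neq0// gt_eqF.
have bg : bdmeas g by apply: bdmeasZ; apply: bdmeasD => //; exact: bdmeas_cst.
have g01 x : 0 <= g x <= 1.
  have := le_trans (fM x) (ler_norm M); rewrite ler_norml => /andP[? ?].
  rewrite /g ler_pdivlMl ?mulr_gt0// ler_pdivrMl ?mulr_gt0//.
  by apply/andP; rewrite /M'; split; lra.
have b1 : bdmeas (fun x => 2 * M' * g x) by exact: bdmeasZ.
have b2 : bdmeas (fun x : T => - M' * cst 1 x) by exact: bdmeasZ.
have H K : positive_linear K -> K f = 2 * M' * K g - M' * K (cst 1).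
  by move=> [KD KZ _]; rewrite {1}fD KD// (KZ (2 * M') g)// (KZ (- M') (cst 1))// mulNr.
by rewrite (H _ pL) (H _ pL') L1 eq01//; case: bg.
Qed.

End LayerSum.

(** * Calculus of the flat distance *)

Section Flat.
Context {R : realType} dT (T : measurableType dT) (dist : T -> T -> R) (B : nat -> set T).
Hypothesis mB : measurable_base dist B.
Implicit Types (f g psi : T -> R) (mu nu rho : {finite_measure set T -> \bar R}).

Lemma lip_bdmeas f k M : (forall x, `|f x| <= M) ->
  (forall x y, `|f x - f y| <= k * dist x y) -> bdmeas f.
Proof. by move=> fM fk; split; [exact: (base_lip_measurable mB fk)|exists M]. Qed.

Lemma BL1_bdmeas psi : BL1 dist psi -> bdmeas psi.
Proof. by move=> [p1 p2]; apply: (@lip_bdmeas _ 1 1) => // x y; rewrite mul1r. Qed.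

Lemma BL1N psi : BL1 dist psi -> BL1 dist (fun x => - psi x).
Proof. by move=> [h1 h2]; split => [x|x y]; rewrite ?normrN// -opprD normrN. Qed.

(** The supremum is one-sided, but the unit ball of BL is stable under negation. Real upper bounds
    [a] in place of the distance itself avoid extended arithmetic in the estimates. *)
Lemma flat_leP mu nu a : (flat dist mu nu <= a%:E)%E <->
  forall psi, BL1 dist psi -> `|\int[mu]_x psi x - \int[nu]_x psi x| <= a.
Proof.
have E psi : BL1 dist psi -> ((\int[mu]_x (psi x)%:E) - (\int[nu]_x (psi x)%:E) =
    (\int[mu]_x psi x - \int[nu]_x psi x)%:E)%E.
  move=> bp; rewrite EFinB !fineK//; apply: integrable_fin_num => //;
  exact/bdmeas_integrable/BL1_bdmeas.
split=> [fa psi bpsi|H].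
  have P p : BL1 dist p -> \int[mu]_x p x - \int[nu]_x p x <= a.
    move=> bp; rewrite -lee_fin -E//; apply: le_trans fa; apply: ereal_sup_ubound.
    by exists p.
  rewrite ler_norml P// andbT.
  have := P _ (BL1N bpsi); have bb := BL1_bdmeas bpsi.
  under eq_Rintegral do rewrite -mulN1r; under [X in _ - X]eq_Rintegral do rewrite -mulN1r.
  by rewrite !RintegralZT//; lra.
apply: ge_ereal_sup => _ [psi bpsi <-]; rewrite E// lee_fin.
by apply: le_trans (H _ bpsi); exact: ler_norm.
Qed.

Lemma BL1_0 : BL1 dist (cst 0).
Proof. by split => [x|x y] /=; rewrite ?subrr normr0//; exact: (mb_ge0 mB). Qed.

Lemma BL1_1 : BL1 dist (cst 1).
Proof. by split => [x|x y] /=; rewrite ?subrr ?normr1 ?normr0//; exact: (mb_ge0 mB). Qed.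

Lemma flat_BL mu nu f C a : 0 < C -> (forall x, `|f x| <= C) ->
  (forall x y, `|f x - f y| <= C * dist x y) -> (flat dist mu nu <= a%:E)%E ->
  `|\int[mu]_x f x - \int[nu]_x f x| <= C * a.
Proof.
move=> C0 fC fl /flat_leP H; have bf := lip_bdmeas fC fl.
have := H (fun x => C^-1 * f x); rewrite !RintegralZT// -mulrBr normrM gtr0_norm ?invr_gt0//.
rewrite ler_pdivrMl//; apply; split => [x|x y].
  by rewrite normrM gtr0_norm ?invr_gt0// ler_pdivrMl// mulr1.
by rewrite -mulrBr normrM gtr0_norm ?invr_gt0// ler_pdivrMl.
Qed.

Lemma flat_mass mu nu a : (flat dist mu nu <= a%:E)%E -> `|mass mu - mass nu| <= a.
Proof. by move=> /flat_leP /(_ _ BL1_1); rewrite !Rintegral_cstT !mul1r. Qed.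

Lemma flat_ge0 mu nu : (0 <= flat dist mu nu)%E.
Proof.
apply: ereal_sup_ubound; exists (cst 0); first exact: BL1_0.
by rewrite !integral0_eq ?sube0.
Qed.

Lemma flat_refl mu a : 0 <= a -> (flat dist mu mu <= a%:E)%E.
Proof. by move=> a0; apply/flat_leP => psi _; rewrite subrr normr0. Qed.

Lemma flat_sym mu nu a : (flat dist mu nu <= a%:E)%E -> (flat dist nu mu <= a%:E)%E.
Proof. by move=> /flat_leP H; apply/flat_leP => psi /H; rewrite distrC. Qed.

Lemma flat_triangle mu nu rho a b : (flat dist mu nu <= a%:E)%E ->
  (flat dist nu rho <= b%:E)%E -> (flat dist mu rho <= (a + b)%:E)%E.
Proof.
move=> h1 h2; apply: (flat_leP mu rho (a + b)).2 => psi bp.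
rewrite (le_trans (ler_distD (\int[nu]_x psi x) _ _))// lerD//.
  exact: (flat_leP mu nu a).1 h1 psi bp.
exact: (flat_leP nu rho b).1 h2 psi bp.
Qed.

Lemma flat_le_mass mu nu : (flat dist mu nu <= (mass mu + mass nu)%:E)%E.
Proof.
apply/flat_leP => psi bp; rewrite (le_trans (ler_normB _ _))//.
have [h _] := bp; have bb := BL1_bdmeas bp.
by rewrite lerD// (le_trans (Rintegral_norm_le _ bb h))// mul1r.
Qed.

Lemma flat_fin mu nu : exists2 a, 0 <= a & flat dist mu nu = a%:E.
Proof.
have := flat_le_mass mu nu; have := flat_ge0 mu nu.
by case: (flat dist mu nu) => // r r0 _; exists r.
Qed.

(** Lipschitz constants in (V2) and (S1) have no prescribed sign, and [a] only bounds the distance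
    from above: hence the maximum with 0. *)
Lemma le_flat_scale (C a : R) (x : \bar R) mu nu : (flat dist mu nu <= a%:E)%E -> 0 <= a ->
  (x <= C%:E * flat dist mu nu)%E -> (x <= (Num.max C 0 * a)%:E)%E.
Proof.
move=> + a0; have [b b0 ->] := flat_fin mu nu; rewrite lee_fin => ba.
move=> /le_trans; apply; rewrite -EFinM lee_fin.
apply: (@le_trans _ _ (Num.max C 0 * b)); first by rewrite ler_wpM2r// le_max lexx.
by rewrite ler_wpM2l// le_max lexx orbT.
Qed.

End Flat.

(** * Compactness for the flat distance *)

Section UltraLimit.
Context {R : realType} (I : Type) (U : set_system I) {UU : UltraFilter U}.

Lemma ultra_cvg (a : I -> R) (M : R) : (forall i, `|a i| <= M) -> exists l : R, a i @[i --> U] --> l.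
Proof.
move=> aM; have [|l [_ cl]] := @segment_compact R (- M) M (a @ U) _.
  by apply: (@filterS _ U _ setT); [move=> i _; rewrite /= in_itv/= -ler_norml|exact: filterT].
exists l => V nV; have [//|UV] := in_ultra_setVsetC (a @^-1` V) UU.
by have [x [nVx Vx]] := cl (~` V) V UV nV.
Qed.

Lemma ultra_cvg_norm_le (a : I -> R) (M l : R) : (forall i, `|a i| <= M) -> a i @[i --> U] --> l -> `|l| <= M.
Proof.
move=> aM al.
apply: (@closed_cvg _ _ U _ (fun i => `|a i|) [set y | y <= M] _ _ _ (cvg_norm al)).
  exact: closed_le.
by apply: filterE => i /=.
Qed.

Lemma ultra_cvg_sum (J : Type) (s : seq J) (F : J -> I -> R) (l : J -> R) :
  (forall j, F j i @[i --> U] --> l j) ->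
  \sum_(j <- s) F j i @[i --> U] --> \sum_(j <- s) l j.
Proof.
move=> Fl; elim: s => [|j s IH].
  by under eq_fun do rewrite big_nil; rewrite big_nil; exact: cvg_cst.
by under eq_fun do rewrite big_cons; rewrite big_cons; apply: cvgD.
Qed.

End UltraLimit.

Section FlatCompactness.
Context {R : realType} {d : nat} (I : Type) (U : set_system I) {UU : UltraFilter U}.
Variables (m : I -> Mplus R d) (r M : R).
Hypothesis m_supp : forall i, m i (~` @cball0 R d r) = 0%E.
Hypothesis m_mass : forall i, mass (m i) <= M.

Let nu (A : set (Rd R d)) : R := lim (fine (m i A) @[i --> U]).

Let m_le i A : measurable A -> `|fine (m i A)| <= M.
Proof.
move=> mA; rewrite ger0_norm ?fine_ge0//; apply: le_trans (m_mass i).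
by apply: fine_le; rewrite ?fin_num_measure// le_measure// inE.
Qed.

Let m_cvg A : measurable A -> fine (m i A) @[i --> U] --> nu A.
Proof.
move=> mA; have [l al] := ultra_cvg (fun i => m_le i mA).
by apply: cvgP al.
Qed.

Let weak_limit : exists mu : Mplus R d, mass mu = nu setT /\
  forall O : set 'rV[R]_d, open O -> fine (mu O) <= nu O.
Proof.
have clK := @closed_cball R d r.
have nuge0 A : measurable A -> 0 <= nu A.
  move=> mA; apply: (@closed_cvg _ _ U _ (fun i => fine (m i A)) [set y | 0 <= y] _ _ _ (m_cvg mA)).
    exact: closed_ge.
  by apply: filterE => i /=; rewrite fine_ge0.
(* [regularization] wants nonnegativity on every set, while the limits are controlled on Borel sets
   only. *)
pose nu' A := if asbool (measurable A) then nu A else 0.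
have [||||mu [mu1 mu2]] := @regularization R d nu' (@cball0 R d r) _ _ _ clK.
- by move=> A; rewrite /nu'; case: asboolP => // /nuge0.
- move=> A C mA mC AC; rewrite /nu' !asboolT//; last exact: measurableU.
  apply: (@cvg_unique _ _ (fine (m i (A `|` C)) @[i --> U])).
  + exact: norm_hausdorff.
  + by apply: m_cvg; exact: measurableU.
  + rewrite (_ : (fun _ => _) = (fun i => fine (m i A) + fine (m i C))).
      by apply: cvgD; exact: m_cvg.
    by apply/funext => i; rewrite measureU// fineD// fin_num_measure.
- exact: compact_cball.
- have mK : measurable (~` @cball0 R d r) by apply: measurableC; exact: closed_Borel.
  rewrite /nu' asboolT//; apply: (@cvg_unique _ _ (fine (m i (~` @cball0 R d r)) @[i --> U])).
  + exact: norm_hausdorff.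
  + exact: m_cvg.
  + rewrite (_ : (fun _ => _) = (fun i => 0)); first exact: cvg_cst.
    by apply/funext => i; rewrite m_supp.
exists mu; split; first by rewrite mu1/= /nu' asboolT.
move=> O oO; have mO := open_Borel oO.
have := mu2 O oO; rewrite /nu' asboolT// -lee_fin fineK//; exact: fin_num_measure.
Qed.

(** Weak convergence treats one test function at a time. If uniformity failed, the offending
    functions would have a pointwise limit along [U], again in the unit ball of BL and uniform on
    the ball by equicontinuity; weak convergence against that limit is a contradiction. *)
Lemma flat_compact : exists mu : Mplus R d, [/\ mu (~` @cball0 R d r) = 0%E, mass mu <= M &
  forall e : R, 0 < e -> U [set i | (flat (@eucl_dist R d) (m i) mu <= e%:E)%E]].
Proof.
have mB := @measurable_base_Rd R d.
have [mu [muT muO]] := weak_limit.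
have clK := @closed_cball R d r.
have mK : measurable (@cball0 R d r) by exact: closed_Borel.
have [i0 _] := filter_ex (@filterT _ U _).
have M0 : 0 <= M by apply: le_trans (m_mass i0); exact: mass_ge0.
have muM : mass mu <= M.
  rewrite muT; apply: le_trans (ler_norm _) _.
  by apply: (ultra_cvg_norm_le (fun i => m_le i measurableT)); exact: m_cvg.
have mu0 : mu (~` @cball0 R d r) = 0%E.
  apply/eqP; rewrite -(@fineK _ (mu _)) ?fin_num_measure//; last exact: measurableC.
  rewrite eqe eq_le fine_ge0// andbT (le_trans (muO _ (closed_openC clK)))//.
  have := m_cvg (measurableC mK).
  rewrite (_ : (fun _ => _) = (fun i => 0)); last by apply/funext => i; rewrite m_supp.
  by move=> h; rewrite (cvg_unique (@norm_hausdorff _ _) h (@cvg_cst _ _ _ _ _)).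
(* Summing the bound on open sets over the superlevel sets of [g] gives only lower semicontinuity of
   the integral. *)
have half g k e : 0 < e -> (forall x, 0 <= g x <= 1) ->
    (forall x y, `|g x - g y| <= k * eucl_dist x y) ->
    U [set i | \int[mu]_x g x <= \int[m i]_x g x + e].
  move=> e0 g01 gk.
  have bg : bdmeas g.
    apply: (lip_bdmeas mB (M := 1) _ gk) => x; have /andP[g0 g1] := g01 x.
    by rewrite ger0_norm.
  have cg : continuous (g : 'rV[R]_d -> R) by exact: (@enorm_lip_continuous _ _ _ k).
  have [N _ HN] : \forall n \near \oo, (n.+1%:R^-1 : R) < e / 2 / (M + 1).
    have e2 : 0 < e / 2 / (M + 1) by rewrite !divr_gt0// ltr_wpDl.
    by apply: near_infty_natSinv_lt (PosNum e2).
  have {HN}HN := HN N (leqnn N).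
  have N0 : 0 < N.+1%:R :> R by [].
  pose A (j : 'I_N.+1) : set 'rV[R]_d := [set x | j%:R < N.+1%:R * g x].
  have oA j : open (A j).
    apply: (@open_comp _ _ (fun x : 'rV[R]_d => N.+1%:R * g x) [set y | j%:R < y]); last exact: open_gt.
    by move=> x _; apply: (@cvgM _ _ _ (nbhs_filter x)); [exact: cvg_cst|exact: cg].
  have mA j : measurable (A j : set (Rd R d)) by exact: open_Borel.
  pose S := layer_sum g N.
  have bS : bdmeas (S : Rd R d -> R) by apply: bdmeas_layer_sum; case: bg.
  have gS x : g x <= S x <= g x + N.+1%:R^-1 by exact: layer_sum_bounds.
  have intS (rho : Mplus R d) : \int[rho]_x S x = N.+1%:R^-1 * \sum_(j < N.+1) fine (rho (A j)).
    by apply: Rintegral_layer_sum; case: bg.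
  have cS : N.+1%:R^-1 * \sum_(j < N.+1) fine (m i (A j)) @[i --> U] -->
      N.+1%:R^-1 * \sum_(j < N.+1) nu (A j).
    apply: cvgM; first exact: cvg_cst.
    by apply: ultra_cvg_sum => j; exact: m_cvg.
  have e2 : 0 < e / 2 by rewrite divr_gt0.
  move/cvgrPdist_lt : cS => /(_ _ e2); apply: filterS => i /= Hi.
  have h1 : \int[mu]_x g x <= \int[mu]_x S x.
    by apply: le_RintegralT => // x; case/andP: (gS x).
  have h2 : \int[m i]_x S x <= \int[m i]_x g x + N.+1%:R^-1 * mass (m i).
    rewrite -Rintegral_cstT -RintegralDT//; last exact: bdmeas_cst.
    apply: le_RintegralT => //; last by move=> x; case/andP: (gS x).
    by apply: bdmeasD => //; exact: bdmeas_cst.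
  have h3 : \int[mu]_x S x <= N.+1%:R^-1 * \sum_(j < N.+1) nu (A j).
    rewrite intS ler_wpM2l ?invr_ge0//; apply: ler_sum => j _; exact: muO.
  have h4 : N.+1%:R^-1 * mass (m i) <= e / 2.
    apply: (@le_trans _ _ (e / 2 / (M + 1) * (M + 1))).
      apply: ler_pM; rewrite ?invr_ge0 ?mass_ge0 ?ltW//.
      by rewrite (le_lt_trans (m_mass i))// ltrDl.
    by rewrite divfK// gt_eqF// ltr_wpDl.
  rewrite -intS in Hi; move: h1 h2 h3 h4 (le_lt_trans (ler_norm _) Hi).
  move: (_ * mass _) (_ * \sum_(j < _) nu _) => X Y; lra.
have pw psi e : 0 < e -> BL1 (@eucl_dist R d) psi ->
    U [set i | `|\int[m i]_x psi x - \int[mu]_x psi x| <= e].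
  move=> e0 bpsi; have bb := BL1_bdmeas mB bpsi; have [p1 p2] := bpsi.
  have e8 : 0 < e / 8 by rewrite divr_gt0.
  (* Both take values in [0, 1] and they add up to 1. As the masses converge, the two one-sided
     bounds give a two-sided one for [psi]. *)
  pose g x := 2^-1 * (1 + psi x); pose g' x := 2^-1 * (1 - psi x).
  have U1 : U [set i | \int[mu]_x g x <= \int[m i]_x g x + e / 8].
    apply: (half _ (2^-1)) => // [x|x y].
      by have := p1 x; rewrite ler_norml /g => /andP[? ?]; apply/andP; split; lra.
    rewrite -mulrBr normrM ger0_norm// ler_pM2l//.
    by rewrite (_ : _ - _ = psi x - psi y) ?p2//; ring.
  have U2 : U [set i | \int[mu]_x g' x <= \int[m i]_x g' x + e / 8].
    apply: (half _ (2^-1)) => // [x|x y].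
      by have := p1 x; rewrite ler_norml /g' => /andP[? ?]; apply/andP; split; lra.
    rewrite -mulrBr normrM ger0_norm// ler_pM2l//.
    by rewrite (_ : _ - _ = psi y - psi x) 1?eucl_distC ?p2//; ring.
  have U3 : U [set i | `|mass mu - mass (m i)| < e / 8].
    by have /cvgrPdist_lt /(_ _ e8) := m_cvg (@measurableT _ (Rd R d)); rewrite muT.
  have ig (rho : Mplus R d) : \int[rho]_x g x = 2^-1 * (mass rho + \int[rho]_x psi x).
    rewrite RintegralZT ?RintegralDT ?Rintegral_cstT ?mul1r//; try exact: bdmeas_cst.
    by apply: bdmeasD => //; exact: bdmeas_cst.
  have ig' (rho : Mplus R d) : \int[rho]_x g' x = 2^-1 * (mass rho - \int[rho]_x psi x).
    rewrite RintegralZT ?RintegralBT ?Rintegral_cstT ?mul1r//; try exact: bdmeas_cst.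
    by apply: bdmeasB => //; exact: bdmeas_cst.
  apply: filterS (filterI U1 (filterI U2 U3)) => i /=; rewrite !ig !ig' => -[h1 [h2]].
  rewrite ltr_norml => /andP[h3 h4].
  by rewrite ler_norml; apply/andP; split; lra.
exists mu; split => // e e0.
have [//|Uc] := in_ultra_setVsetC [set i | (flat (@eucl_dist R d) (m i) mu <= e%:E)%E] UU.
exfalso.
(* A violating function is selected wherever the distance exceeds [e]; elsewhere the zero function
   is a placeholder. *)
have [psi Hpsi] : {psi : I -> Rd R d -> R & forall i, BL1 (@eucl_dist R d) (psi i) /\
    ((flat (@eucl_dist R d) (m i) mu <= e%:E)%E \/
     e < `|\int[m i]_x psi i x - \int[mu]_x psi i x|)}.
  apply: (@choice _ _ (fun i psi => BL1 (@eucl_dist R d) psi /\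
    ((flat (@eucl_dist R d) (m i) mu <= e%:E)%E \/
     e < `|\int[m i]_x psi x - \int[mu]_x psi x|))) => i.
  have [H|H] := pselect (flat (@eucl_dist R d) (m i) mu <= e%:E)%E.
    by exists (cst 0); split; [exact: BL1_0 mB|left].
  have /existsNP[p /not_implyP[bp /negP]] : ~ (forall psi, BL1 (@eucl_dist R d) psi ->
      `|\int[m i]_x psi x - \int[mu]_x psi x| <= e).
    by move=> K; apply: H; apply/(flat_leP mB).
  by rewrite -ltNge => h; exists p; split => //; right.
have [l Hl] : {l : Rd R d -> R & forall x, psi i x @[i --> U] --> l x}.
  apply: (@choice _ _ (fun x y => psi i x @[i --> U] --> y)) => x.
  by apply: (@ultra_cvg _ _ _ _ _ 1) => i; have [[h _] _] := Hpsi i; exact: h.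
have bl : BL1 (@eucl_dist R d) l.
  split=> [x|x y].
    by apply: (ultra_cvg_norm_le _ (Hl x)) => i; have [[h _] _] := Hpsi i; exact: h.
  by apply: (ultra_cvg_norm_le _ (cvgB (Hl x) (Hl y))) => i; have [[_ h] _] := Hpsi i; exact: h.
have [l1 l2] := bl.
(* Replacing [psi i] by [l] then costs at most [e / 4] under each of [m i] and [mu], and weak
   convergence against [l] a third [e / 4]. *)
pose del := e / 4 / (M + 1).
have M1 : 0 < M + 1 by rewrite ltr_wpDl.
have del0 : 0 < del by rewrite !divr_gt0.
have delM (rho : Mplus R d) : mass rho <= M -> del * mass rho <= e / 4.
  move=> rM; apply: (@le_trans _ _ (del * (M + 1))); last by rewrite divfK// gt_eqF.
  by rewrite ler_pM2l// (le_trans rM)// lerDl.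
have U1 : U [set i | forall x, @cball0 R d r x -> `|psi i x - l x| <= del].
  have := @compact_cball R d r => /compact_near_coveringP /(_ I U (fun i x => `|psi i x - l x| <= del)).
  (* Both functions are 1-Lipschitz, so closeness at [x] spreads to a ball of radius [del / 4], with
     total error three quarters of [del]. *)
  apply => x _; have d4 : 0 < del / 4 by rewrite divr_gt0.
  exists ([set y | enorm (x - y) < del / 4], [set i | `|l x - psi i x| < del / 4]).
    split => /=; last by have /cvgrPdist_lt /(_ _ d4) := Hl x.
    have cc : continuous (fun y : 'rV[R]_d => enorm (x - y)).
      apply: (@enorm_lip_continuous _ _ _ 1) => y z.
      by rewrite mul1r (le_trans (enorm_lip _ _))// opprB addrC subrKA enormB.
    apply: (cc x [set z | z < del / 4]); apply: open_nbhs_nbhs; split; first exact: open_lt.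
    by rewrite /= subrr enorm0.
  move=> [y i] [/= xy li]; have [[_ q2] _] := Hpsi i.
  have h1 : `|psi i x - psi i y| <= enorm (x - y) := q2 x y.
  have h2 : `|l x - l y| <= enorm (x - y) := l2 x y.
  move: h1 h2 li; rewrite ltr_norml !ler_norml => /andP[? ?] /andP[? ?] /andP[? ?].
  by apply/andP; split; lra.
have e4 : 0 < e / 4 by rewrite divr_gt0.
have [i [ni [Hi1 Hi2]]] := filter_ex (filterI Uc (filterI U1 (pw l _ e4 bl))).
have [bi [//|]] := Hpsi i; apply/negP; rewrite -leNgt.
have bbi := BL1_bdmeas mB bi; have bbl := BL1_bdmeas mB bl.
have k1 := Rintegral_dist_le mK (m_supp i) bbi bbl (ltW del0) Hi1.
have k2 := Rintegral_dist_le mK mu0 bbi bbl (ltW del0) Hi1.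
have := delM _ muM; have := delM _ (m_mass i); move: k1 k2 Hi2.
set a := del * _; set b := del * _; rewrite /= !ler_norml.
by move=> /andP[? ?] /andP[? ?] /andP[? ?] ? ?; apply/andP; split; lra.
Qed.

End FlatCompactness.

(** * Test functions *)

Section Calculus.
Context {R : realType} {d : nat}.
Implicit Types (f g : 'rV[R]_d -> R) (x y z : 'rV[R]_d).

Lemma is_derive_line g z (i : 'I_d) t : derivable g (z + t *: ei R i) (ei R i) ->
  is_derive t (1 : R) (fun s => g (z + s *: ei R i)) ('D_(ei R i) g (z + t *: ei R i)).
Proof.
move=> dg.
have E : (fun h => h^-1 *: (((fun s => g (z + s *: ei R i)) \o shift t) (h *: (1 : R)) - g (z + t *: ei R i))) =
  (fun h => h^-1 *: ((g \o shift (z + t *: ei R i)) (h *: ei R i) - g (z + t *: ei R i))).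
  apply/funext => h /=; congr (_ *: (g _ - _)).
  by rewrite [_ *: 1]mulr1 scalerDl addrCA.
by apply: DeriveDef; rewrite /derivable /derive E.
Qed.

Lemma coord_mvt g (i : 'I_d) z a : (forall x, derivable g x (ei R i)) ->
  exists2 t : R, `|t| <= `|a| &
    g (z + a *: ei R i) - g z = 'D_(ei R i) g (z + t *: ei R i) * a.
Proof.
move=> dg; pose phi s := g (z + s *: ei R i); pose phi' s := 'D_(ei R i) g (z + s *: ei R i).
have dphi s : is_derive s (1 : R) phi (phi' s) by exact: is_derive_line.
have cphi (u v : R) : {within `[u, v], continuous phi}.
  apply: continuous_subspaceT => s; apply: differentiable_continuous.
  by apply/derivable1_diffP; case: (dphi s).
have phi0 : phi 0 = g z by rewrite /phi scale0r addr0.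
have [a0|a0] := leP 0 a.
  have [c] := MVT_segment a0 (fun s _ => dphi s) (cphi _ _).
  rewrite in_itv/= => /andP[c0 ca]; rewrite phi0 subr0 => E.
  by exists c => //; rewrite !ger0_norm.
have [c] := MVT_segment (ltW a0) (fun s _ => dphi s) (cphi _ _).
rewrite in_itv/= => /andP[ac c0]; rewrite phi0 sub0r => E.
exists c; first by rewrite !ler0_norm ?lerN2// ltW.
by rewrite -[LHS]opprB -/(phi a) E mulrN opprK.
Qed.

(* Mean value theorem along the axis-parallel path from [x] to [x + y]. *)
Lemma path_mvt g x y : (forall i x, derivable g x (ei R i)) ->
  exists2 xi : 'I_d -> 'rV[R]_d, (forall i, enorm (xi i - x) <= enorm y) &
    g (x + y) - g x = \sum_(i < d) 'D_(ei R i) g (xi i) * y ord0 i.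
Proof.
move=> dg; pose P (k : nat) : 'rV[R]_d := \row_(j < d) (if (j < k)%N then y ord0 j else 0).
have PS (i : 'I_d) : P i.+1 = P i + y ord0 i *: ei R i.
  apply/rowP => j; rewrite !mxE eqxx/= ltnS leq_eqVlt.
  have [->|ij] := eqVneq j i; first by rewrite eqxx ltnn/= mulr1 add0r.
  by rewrite val_eqE (negbTE ij)/= mulr0 addr0.
have [t Ht] : {t : 'I_d -> R & forall i, `|t i| <= `|y ord0 i| /\
    g (x + P i.+1) - g (x + P i) = 'D_(ei R i) g (x + P i + t i *: ei R i) * y ord0 i}.
  apply: (@choice _ _ (fun (i : 'I_d) (t : R) => `|t| <= `|y ord0 i| /\
    g (x + P i.+1) - g (x + P i) = 'D_(ei R i) g (x + P i + t *: ei R i) * y ord0 i)) => i.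
  have [t ty E] := coord_mvt (x + P i) (y ord0 i) (dg i).
  by exists t; split => //; rewrite PS addrA.
exists (fun i : 'I_d => x + P i + t i *: ei R i).
  move=> i; rewrite -(addrA x) [x + _]addrC addrK ler_wsqrtr//; apply: ler_sum => j _.
  rewrite -[leLHS]real_normK ?num_real// -[leRHS]real_normK ?num_real// lerXn2r ?nnegrE//.
  rewrite !mxE eqxx/=; have [->|ij] := eqVneq j i.
    by rewrite ltnn mulr1 add0r; case: (Ht i).
  by rewrite mulr0 addr0; case: ifP => //; rewrite normr0.
under eq_bigr => i _ do rewrite -(Ht i).2.
rewrite -(big_mkord xpredT (fun i : nat => g (x + P i.+1) - g (x + P i))) telescope_sumr//.
congr (g (x + _) - g _).
  by apply/rowP => j; rewrite mxE ltn_ord.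
by rewrite (_ : P 0 = 0) ?addr0//; apply/rowP => j; rewrite !mxE.
Qed.

Lemma lip_of_partials g B : (forall i x, derivable g x (ei R i)) ->
  (forall i x, `|'D_(ei R i) g x| <= B) -> forall x y, `|g x - g y| <= d%:R * B * enorm (x - y).
Proof.
move=> dg gB x y; have [xi _] := path_mvt y (x - y) dg; rewrite [y + _]addrC subrK => ->.
rewrite -mulrA -[X in X%:R * _]card_ord -sum1_card natr_sum mulr_suml.
apply: (le_trans (ler_norm_sum _ _ _)); apply: ler_sum => i _.
by rewrite mul1r normrM ler_pM// coord_le_enorm.
Qed.

Lemma compact_support_bounded g r : continuous g -> (forall x, r < enorm x -> g x = 0) ->
  exists2 C, 0 < C & forall x, `|g x| <= C.
Proof.
move=> cg g0; have cgT : {within [set x : 'rV[R]_d | enorm x <= r], continuous g}.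
  exact: continuous_subspaceT.
have [M [_ HM]] := compact_bounded (continuous_compact cgT (@compact_cball R d r)).
exists (`|M| + 1); first by rewrite ltr_wpDl.
move=> x; have [xr|xr] := leP (enorm x) r; last by rewrite g0// normr0.
apply: (HM (`|M| + 1)); last by exists x.
by rewrite (le_lt_trans (ler_norm _))// ltrDl.
Qed.

Lemma partial_support g r (i : 'I_d) : (forall x, r < enorm x -> g x = 0) ->
  forall x, r < enorm x -> 'D_(ei R i) g x = 0.
Proof.
move=> g0 x rx; rewrite -(derive_cst (0 : R) x (ei R i)).
apply: near_eq_derive.
have : \forall y \near x, r < enorm y.
  apply: (@enorm_continuous R d x [set t | r < t]).
  by apply: open_nbhs_nbhs; split => //; exact: open_gt.
by apply: filterS => y /g0.
Qed.

(** For the quadratic remainder, [path_mvt] evaluates the partials at points within [enorm y] of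
    [x], and these partials are Lipschitz because the second ones are bounded. One [C] serves every
    bound. *)
Lemma test_fun_bounds f : test_fun f -> exists C, [/\ 0 < C,
  (forall x, `|f x| <= C) /\ (forall x y, `|f x - f y| <= C * enorm (x - y)),
  (forall i x, `|'D_(ei R i) f x| <= C) /\
  (forall i x y, `|'D_(ei R i) f x - 'D_(ei R i) f y| <= C * enorm (x - y)) &
  forall x y, `|f (x + y) - f x - grad_dot f x y| <= C * enorm y ^+ 2].
Proof.
move=> [sf [r f0]].
have [C0 C00 H0] := compact_support_bounded (sf [::]).1 f0.
have g0 i := partial_support i f0.
have h0 i j := partial_support j (g0 i).
have [C1 HC1] : {C1 : 'I_d -> R & forall i, 0 < C1 i /\ forall x, `|'D_(ei R i) f x| <= C1 i}.
  apply: (@choice _ _ (fun i C => 0 < C /\ forall x, `|'D_(ei R i) f x| <= C)) => i.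
  by have [C ? ?] := compact_support_bounded (sf [:: i]).1 (g0 i); exists C.
have [C2 HC2] : {C2 : 'I_d * 'I_d -> R & forall p, 0 < C2 p /\
    forall x, `|'D_(ei R p.2) (fun x => 'D_(ei R p.1) f x) x| <= C2 p}.
  apply: (@choice _ _ (fun p C => 0 < C /\
    forall x, `|'D_(ei R p.2) (fun x => 'D_(ei R p.1) f x) x| <= C)) => -[i j].
  by have [C ? ?] := compact_support_bounded (sf [:: j; i]).1 (h0 i j); exists C.
pose K1 := \sum_i C1 i; pose K2 := \sum_p C2 p.
have K10 : 0 <= K1 by apply: sumr_ge0 => i _; rewrite ltW//; case: (HC1 i).
have K20 : 0 <= K2 by apply: sumr_ge0 => i _; rewrite ltW//; case: (HC2 i).
have D0 : 0 <= d%:R :> R by [].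
have f1 i x : `|'D_(ei R i) f x| <= K1.
  rewrite (le_trans ((HC1 i).2 x))// /K1 (bigD1 i)//= lerDl.
  by apply: sumr_ge0 => j _; rewrite ltW//; case: (HC1 j).
have f2 i j x : `|'D_(ei R j) (fun x => 'D_(ei R i) f x) x| <= K2.
  rewrite (le_trans ((HC2 (i, j)).2 x))// /K2 (bigD1 (i, j))//= lerDl.
  by apply: sumr_ge0 => p _; rewrite ltW//; case: (HC2 p).
have l1 := lip_of_partials (fun i x => (sf [::]).2 i x) f1.
have l2 i := lip_of_partials (fun j x => (sf [:: i]).2 j x) (f2 i).
have Dk1 : 0 <= d%:R * K1 by rewrite mulr_ge0.
have Dk2 : 0 <= d%:R * K2 by rewrite mulr_ge0.
have Dk3 : 0 <= d%:R * (d%:R * K2) by rewrite mulr_ge0.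
exists (C0 + K1 + d%:R * K1 + d%:R * K2 + d%:R * (d%:R * K2)); split.
- lra.
- split=> [x|x y]; first by rewrite (le_trans (H0 x))//; lra.
  by rewrite (le_trans (l1 x y))// ler_wpM2r ?enorm_ge0//; lra.
- split=> [i x|i x y]; first by rewrite (le_trans (f1 i x))//; lra.
  by rewrite (le_trans (l2 i x y))// ler_wpM2r ?enorm_ge0//; lra.
- move=> x y; have [xi Hxi ->] := path_mvt x y (fun i x => (sf [::]).2 i x).
  apply: (@le_trans _ _ (d%:R * (d%:R * K2) * enorm y ^+ 2)); last first.
    by rewrite ler_wpM2r ?sqr_ge0//; lra.
  rewrite -sumrB (le_trans (ler_norm_sum _ _ _))//.
  rewrite -[X in _ <= X%:R * _ * _]card_ord -sum1_card natr_sum -mulrA mulr_suml.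
  apply: ler_sum => i _; rewrite mul1r -mulrBl normrM expr2 mulrA.
  apply: ler_pM => //; last exact: coord_le_enorm.
  by rewrite (le_trans (l2 i _ _))// ler_wpM2l.
Qed.

End Calculus.

(** * Weighted push-forward *)

Section WeightedPushforward.
Context {R : realType} d1 (T : measurableType d1) d2 (T' : measurableType d2).
Variables (mu : {finite_measure set T -> \bar R}) (sigma : {finite_measure set T' -> \bar R}).
Variables (phi : T -> T') (w : T -> R) (h : R).
Hypothesis mphi : measurable_fun setT phi.
Hypothesis bw : bdmeas w.
Hypothesis w0 : forall x, 0 <= w x.
Hypothesis h0 : 0 <= h.

Let dens (A : set T) : \bar R := (\int[mu]_(x in A) (w x)%:E)%E.

Let dens0 : dens set0 = 0%E. Proof. by rewrite /dens integral_set0. Qed.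

Let dens_ge0 A : (0 <= dens A)%E.
Proof. by apply: integral_ge0 => x _; rewrite lee_fin. Qed.

Let dens_sigma : semi_sigma_additive dens.
Proof.
apply: semi_sigma_additive_nng_induced => [|x]; last by rewrite lee_fin.
by apply/measurable_EFinP; case: bw.
Qed.

HB.instance Definition _ := isMeasure.Build _ T R dens dens0 dens_ge0 dens_sigma.

Let hh : {nonneg R} := NngNum h0.

Let nu (A : set T') : \bar R := (dens (phi @^-1` A) + mscale hh sigma A)%E.

Let nu0 : nu set0 = 0%E. Proof. by rewrite /nu preimage_set0 !measure0 adde0. Qed.

Let nu_ge0 A : (0 <= nu A)%E. Proof. by rewrite adde_ge0// measure_ge0. Qed.

Let mpre A : measurable A -> measurable (phi @^-1` A).
Proof. by move=> mA; rewrite -[X in measurable X]setTI; exact: mphi. Qed.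

Let nu_sigma : semi_sigma_additive nu.
Proof.
move=> F mF tF mUF; rewrite /nu preimage_bigcup.
under eq_fun do rewrite big_split/=.
apply: cvgeD.
- by rewrite ge0_adde_def// inE measure_ge0.
- apply: (@measure_semi_sigma_additive _ _ _ dens (fun n => phi @^-1` F n)).
  + by move=> n; exact: mpre.
  + apply/trivIsetP => /= i j _ _ ij; rewrite -preimage_setI.
    by move/trivIsetP : tF => /(_ _ _ _ _ ij) ->//; rewrite preimage_set0.
  + by rewrite -preimage_bigcup; exact: mpre.
- exact: measure_semi_sigma_additive.
Qed.

HB.instance Definition _ := isMeasure.Build _ T' R nu nu0 nu_ge0 nu_sigma.

Let w_int A : measurable A -> mu.-integrable A (EFin \o w).
Proof. by move=> mA; apply: integrableS (bdmeas_integrable mu bw). Qed.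

Let nu_fin : fin_num_fun nu.
Proof.
move=> A mA; rewrite /nu fin_numD; apply/andP; split.
  by apply: integrable_fin_num; [exact: mpre|apply: w_int; exact: mpre].
by rewrite /mscale fin_numM// fin_num_measure.
Qed.

HB.instance Definition _ := @Measure_isFinite.Build _ T' R nu nu_fin.

(** The measure is the image under [phi] of the density [w] against [mu], plus [h] times [sigma];
    both sides of the identity are positive linear in [f], so indicators decide. *)
Lemma weighted_pushforward : exists nu : {finite_measure set T' -> \bar R},
  forall f, bdmeas f ->
    \int[nu]_x f x = \int[mu]_x (w x * f (phi x)) + h * \int[sigma]_x f x.
Proof.
exists nu => f bf.
have bwf g : bdmeas g -> bdmeas (fun x => w x * g (phi x)).
  by move=> bg; apply: (bdmeasM bw); exact: (bdmeas_comp mphi bg).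
apply: (@eq_positive_linear _ _ _ (fun f => \int[nu]_x f x)
  (fun f => \int[mu]_x (w x * f (phi x)) + h * \int[sigma]_x f x)) => //.
- exact: positive_linear_Rintegral.
- split=> [f1 f2 b1 b2|a f1 b1|f1 f2 b1 b2 f12].
  + cbv beta; rewrite (RintegralDT sigma b1 b2) mulrDr addrACA -(RintegralDT mu (bwf _ b1) (bwf _ b2)).
    by congr (_ + _); apply: eq_Rintegral => x _; rewrite mulrDr.
  + cbv beta; rewrite (RintegralZT sigma a b1) mulrDr mulrCA -(RintegralZT mu a (bwf _ b1)).
    by congr (_ + _); apply: eq_Rintegral => x _; rewrite mulrCA.
  + cbv beta; apply: lerD; last by rewrite ler_wpM2l// le_RintegralT.
    by apply: le_RintegralT; [exact: bwf|exact: bwf|move=> x; rewrite ler_wpM2l].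
- move=> A mA; cbv beta; rewrite !Rintegral_indicT//.
  have -> : fine (nu A) = fine (dens (phi @^-1` A) + mscale hh sigma A)%E by [].
  rewrite fineD; last 2 first.
  + by apply: integrable_fin_num; [exact: mpre|apply: w_int; exact: mpre].
  + by rewrite /mscale fin_numM// fin_num_measure.
  congr (_ + _); last by rewrite /mscale fineM// fin_num_measure.
  rewrite [LHS]Rintegral_mkcond; apply: eq_Rintegral => x _.
  rewrite patchE indicE; have [/set_mem Ax|Ax] := boolP (x \in _).
    by rewrite mem_set// mulr1.
  rewrite memNset ?mulr0// => Aphi; move/negP: Ax; apply; exact: mem_set.
Qed.

End WeightedPushforward.

(** * Quadratic remainders and integration in time *)

Section QuadraticRemainder.
Context {R : realType} (F G : R -> R) (T C : R).
Hypothesis T0 : 0 < T.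
Hypothesis FG : forall t t' : R, 0 <= t <= T -> 0 <= t' <= T ->
  `|F t' - F t - (t' - t) * G t| <= C * (t' - t) ^+ 2.
Hypothesis Glip : forall t t' : R, 0 <= t <= T -> 0 <= t' <= T -> `|G t - G t'| <= C * `|t - t'|.

(** Nothing is assumed outside [0, T]; composing with the projection onto it yields functions
    continuous on the whole line. *)
Let clamp (t : R) := if t < 0 then 0 else if T < t then T else t.

Let clamp_itv t : 0 <= clamp t <= T.
Proof.
have T0' : 0 < T := T0.
by rewrite /clamp; case: (ltP t 0) => ?; case: (ltP T t) => ?; apply/andP; split; lra.
Qed.

Let clamp_id t : 0 <= t <= T -> clamp t = t.
Proof. by move=> /andP[a b]; rewrite /clamp !ltNge a b. Qed.

Let clamp_lip t t' : `|clamp t - clamp t'| <= `|t - t'|.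
Proof.
have T0' : 0 < T := T0; have h1 := ler_norm (t - t'); have := ler_norm (t' - t); rewrite distrC => h2.
rewrite /clamp ler_norml; case: (ltP t 0) => ?; case: (ltP t' 0) => ?;
  case: (ltP T t) => ?; case: (ltP T t') => ?; by apply/andP; split; lra.
Qed.

Let lip_continuous (H : R -> R) k : (forall t t', `|H t - H t'| <= k * `|t - t'|) -> continuous H.
Proof.
move=> Hk x; apply/cvgrPdist_lt => e e0; apply/nbhs_ballP.
have k0 : 0 < `|k| + 1 by rewrite ltr_wpDl.
exists (e / (`|k| + 1)) => /=; first by rewrite divr_gt0.
move=> y; rewrite /ball_/= ltr_pdivlMr// => xy.
apply: le_lt_trans (Hk _ _) (le_lt_trans _ xy); rewrite mulrC ler_wpM2l//.
by rewrite (le_trans (ler_norm _))// lerDl.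
Qed.

Lemma remainder_coef_ge0 : 0 <= C.
Proof.
have h0 : 0 <= (0 : R) <= T by rewrite lexx ltW.
have hT : 0 <= T <= T by rewrite lexx ltW.
have := Glip h0 hT; rewrite sub0r normrN (gtr0_norm T0).
by move=> /(le_trans (normr_ge0 _)); rewrite pmulr_lge0.
Qed.

Lemma lip_on_itv_continuous : continuous (G \o clamp).
Proof.
apply: (@lip_continuous _ C) => t t' /=; apply: le_trans (Glip (clamp_itv t) (clamp_itv t')) _.
by rewrite ler_wpM2l ?remainder_coef_ge0.
Qed.

Lemma lip_on_itv_integrable t : 0 <= t <= T ->
  lebesgue_measure.-integrable [set r : R | 0 <= r <= t] (EFin \o G).
Proof.
move=> /andP[t0 tT].
have -> : [set r : R | 0 <= r <= t] = `[0, t]%classic.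
  by apply/seteqP; split => r; rewrite /= in_itv.
apply: (@eq_integrable _ _ R lebesgue_measure _ _ (EFin \o (G \o clamp))) => //.
  move=> r /set_mem; rewrite /= in_itv/= => /andP[r0 rt].
  by rewrite clamp_id// r0 (le_trans rt).
apply: continuous_compact_integrable; first exact: segment_compact.
by apply: continuous_subspaceT; exact: lip_on_itv_continuous.
Qed.

Lemma integral_of_quadratic_remainder t : 0 <= t <= T ->
  F t - F 0 = \int[lebesgue_measure]_(r in [set r : R | 0 <= r <= t]) G r.
Proof.
move=> /andP[t0 tT].
have -> : [set r : R | 0 <= r <= t] = `[0, t]%classic.
  by apply/seteqP; split => r; rewrite /= in_itv.
move: t0; rewrite le_eqVlt => /orP[/eqP <-|t0].
  by rewrite set_itv1 Rintegral_set1 subrr.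
have in0 r : 0 <= r <= t -> 0 <= r <= T by move=> /andP[-> /le_trans ->].
(* In this constant, [C * T] + [|G 0|] bounds [G] on [0, T] and the other [C * T] absorbs the
   quadratic remainder. *)
have FC : continuous (F \o clamp).
  apply: (@lip_continuous _ (C * T + `|G 0| + C * T)) => u v /=.
  have [hu hv] := (clamp_itv u, clamp_itv v).
  have h1 := FG hv hu; have h0 : 0 <= (0 : R) <= T by rewrite lexx ltW.
  have h2 := Glip hv h0; rewrite subr0 in h2.
  have C0 := remainder_coef_ge0.
  have /andP[v0 vT] := hv; have /andP[u0 uT] := hu; rewrite (ger0_norm v0) in h2.
  have h3 : `|G (clamp v)| <= C * T + `|G 0|.
    have := ler_normD (G (clamp v) - G 0) (G 0); rewrite subrK => /le_trans; apply.
    by rewrite lerD2r (le_trans h2)// ler_wpM2l.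
  have h4 : C * (clamp u - clamp v) ^+ 2 <= C * T * `|clamp u - clamp v|.
    rewrite -mulrA ler_wpM2l// -real_normK ?num_real// expr2 ler_wpM2r//.
    by rewrite ler_norml; apply/andP; split; lra.
  have h5 : `|F (clamp u) - F (clamp v)| <= (C * T + `|G 0| + C * T) * `|clamp u - clamp v|.
    have h6 : `|(clamp u - clamp v) * G (clamp v)| <= (C * T + `|G 0|) * `|clamp u - clamp v|.
      by rewrite normrM mulrC ler_wpM2r.
    have := ler_normD (F (clamp u) - F (clamp v) - (clamp u - clamp v) * G (clamp v))
      ((clamp u - clamp v) * G (clamp v)); rewrite subrK.
    move: h1 h4 h6; lra.
  by rewrite (le_trans h5)// ler_wpM2l// !addr_ge0// mulr_ge0// ltW.
have dF x : x \in `]0, t[ -> is_derive x (1 : R) (F \o clamp) (G x).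
  rewrite in_itv/= => /andP[x0 xt].
  have xT : 0 <= x <= T by rewrite ltW//= (le_trans (ltW xt)).
  suff key : (fun h => h^-1 *: (((F \o clamp) \o shift x) (h *: (1 : R)) - (F \o clamp) x)) @ 0^' --> G x.
    apply: DeriveDef; first by apply/cvg_ex; exists (G x).
    exact: cvg_lim key.
  apply/cvgrPdist_le => e e0.
  (* The first bound makes the remainder over [h] at most [e]; the others keep [h + x] between 0 and
     [t], where [clamp] is the identity. *)
  have de : 0 < Num.min (e / (C + 1)) (Num.min x (t - x)).
    by rewrite !lt_min x0 subr_gt0 xt divr_gt0// ltr_wpDl// remainder_coef_ge0.
  near=> h.
  have h0 : h != 0 by near: h; exact: nbhs_dnbhs_neq.
  have hd : `|h| < Num.min (e / (C + 1)) (Num.min x (t - x)).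
    by near: h; apply: dnbhs0_lt.
  move: hd; rewrite !lt_min => /and3P[h1 h2 h3].
  have xh : 0 <= h + x <= T.
    by move: h2 h3; rewrite !ltr_norml => /andP[? ?] /andP[? ?]; apply/andP; split; lra.
  rewrite /= [h *: 1]mulr1 !clamp_id// distrC.
  have := FG xT xh; rewrite addrK => Q.
  rewrite (_ : _ - G x = h^-1 * (F (h + x) - F x - h * G x)); last first.
    by rewrite [in RHS]mulrBr mulKf.
  rewrite normrM normfV ler_pdivrMl ?normr_gt0//; apply: (le_trans Q).
  rewrite -real_normK ?num_real// expr2 mulrA mulrC ler_wpM2l//.
  move: h1; rewrite ltr_pdivlMr ?ltr_wpDl// ?remainder_coef_ge0// => h1.
  by rewrite (le_trans _ (ltW h1))// mulrC ler_wpM2l// lerDl.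
have := @continuous_FTC2 R (G \o clamp) (F \o clamp) 0 t t0.
have wG : {within `[0, t], continuous (G \o clamp)}.
  by apply: continuous_subspaceT; exact: lip_on_itv_continuous.
move=> /(_ wG).
have cid r : 0 <= r <= t -> clamp r = r by move=> /in0 /clamp_id.
have -> : \int[lebesgue_measure]_(x in `[0, t]) G x = \int[lebesgue_measure]_(x in `[0, t]) (G \o clamp) x.
  by apply: eq_Rintegral => r /set_mem; rewrite /= in_itv/= => /cid ->.
rewrite /Rintegral => ->.
- by rewrite /= !cid ?lexx ?ltW.
- split.
  + by move=> x xi; case: (dF x xi).
  + by apply: cvg_at_right_filter; exact: FC.
  + by apply: cvg_at_left_filter; exact: FC.
- move=> x xi; rewrite derive1E; case: (dF x xi) => _ ->.
  by rewrite /= cid//; move: xi; rewrite in_itv/= => /andP[/ltW -> /ltW ->].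
Unshelve. all: by end_near. Qed.

End QuadraticRemainder.

(** * The Euler scheme *)

Section Euler.
Context {R : realType} {d : nat}.
Variables (V : Mplus R d -> Mplus2 R d) (s : Mplus R d -> Mplus R d)
  (c : 'rV[R]_d -> Mplus R d -> R).
Variables (CS L rs Cb CL : R).
Hypothesis V_marginal : forall (mu : Mplus R d) (A : set (Rd R d)), measurable A ->
  V mu [set p | A p.1] = mu A.
Hypothesis CS0 : 0 < CS.
Hypothesis V_speed : forall (mu : Mplus R d) (p : (Rd R d * Rd R d)%type),
  supp (@eucl_dist2 R d) (V mu) p ->
  ((enorm (p.2 : 'rV[R]_d))%:E <= CS%:E *
     (1 + ereal_sup [set (enorm (q.1 : 'rV[R]_d))%:E | q in supp (@eucl_dist2 R d) (V mu)]))%E.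
Hypothesis V_lip : forall r : R, 0 < r -> exists CF : R, forall mu nu : Mplus R d,
  supp (@eucl_dist R d) mu `<=` @Defs.ball0 R d r -> supp (@eucl_dist R d) nu `<=` @Defs.ball0 R d r ->
  (flat (@eucl_dist2 R d) (V mu) (V nu) <= CF%:E * flat (@eucl_dist R d) mu nu)%E.
Hypothesis s_lip : forall mu nu : Mplus R d,
  (flat (@eucl_dist R d) (s mu) (s nu) <= L%:E * flat (@eucl_dist R d) mu nu)%E.
Hypothesis s_supp : forall mu : Mplus R d, supp (@eucl_dist R d) (s mu) `<=` @Defs.ball0 R d rs.
Hypothesis Cb0 : 0 < Cb.
Hypothesis c_bound : forall x mu, `|c x mu| <= Cb.
Hypothesis CL0 : 0 < CL.
Hypothesis c_lip : forall x y (mu nu : Mplus R d),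
  (`|c x mu - c y nu|%:E <= CL%:E * ((enorm (x - y))%:E + flat (@eucl_dist R d) mu nu))%E.

Local Notation flat1 := (flat (@eucl_dist R d)).
Local Notation flat2 := (flat (@eucl_dist2 R d)).
Local Notation mB1 := (@measurable_base_Rd R d).
Local Notation mB2 := (@measurable_base_Rd2 R d).
Implicit Types (mu nu : Mplus R d) (f : 'rV[R]_d -> R) (p q : (Rd R d * Rd R d)%type).

Lemma measurable_cball r : measurable (@cball0 R d r).
Proof. by apply: closed_Borel; exact: closed_cball. Qed.

Lemma null_supp_cball mu r x : mu (~` @cball0 R d r) = 0%E -> supp (@eucl_dist R d) mu x ->
  enorm (x : 'rV[R]_d) <= r.
Proof.
move=> mu0 sx; rewrite leNgt; apply/negP => rx.
apply: (null_supp mB1 (measurableC (measurable_cball r)) mu0 _ sx).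
exists (enorm (x : 'rV[R]_d) - r); first by rewrite subr_gt0.
move=> y /= xy; rewrite /cball0 /=; apply/negP; rewrite -ltNge.
have := enorm_lip (x : 'rV[R]_d) y; move: xy; rewrite /eucl_dist.
by have := ler_norm (enorm (x : 'rV[R]_d) - enorm (y : 'rV[R]_d)); lra.
Qed.

Lemma supp_cball_null mu r : supp (@eucl_dist R d) mu `<=` @cball0 R d r ->
  mu (~` @cball0 R d r) = 0%E.
Proof.
move=> sr; apply: (supp_null mB1); first exact: measurableC (measurable_cball r).
by apply/seteqP; split => // x [nx /sr].
Qed.

Definition phase_set r : set (Rd R d * Rd R d) :=
  [set p | enorm (p.1 : 'rV[R]_d) <= r /\ enorm (p.2 : 'rV[R]_d) <= CS * (1 + r)].

Lemma measurable_phase_set r : measurable (phase_set r).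
Proof. exact: (measurableX (measurable_cball r) (measurable_cball (CS * (1 + r)))). Qed.

(** The marginal condition bounds the positions in the support of [V mu] by [r]; (V1) then turns
    this supremum of positions into a bound on speeds. *)
Lemma V_phase_set mu r : mu (~` @cball0 R d r) = 0%E -> V mu (~` phase_set r) = 0%E.
Proof.
move=> mu0; apply: (supp_null mB2); first exact: measurableC (measurable_phase_set r).
have s1 q : supp (@eucl_dist2 R d) (V mu) q -> enorm (q.1 : 'rV[R]_d) <= r.
  move=> sq; rewrite leNgt; apply/negP => rq.
  have mA := measurableC (measurable_cball r).
  have VA : V mu [set p | (~` @cball0 R d r) p.1] = 0%E by rewrite V_marginal.
  apply: (null_supp mB2 _ VA _ sq).
    have := @measurable_fst _ _ (Rd R d) (Rd R d) measurableT _ mA; rewrite setTI; exact.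
  exists (enorm (q.1 : 'rV[R]_d) - r); first by rewrite subr_gt0.
  move=> y /= qy; rewrite /cball0 /=; apply/negP; rewrite -ltNge.
  have := enorm_lip (q.1 : 'rV[R]_d) y.1; have := eucl_dist_fst_le q y; rewrite /eucl_dist.
  by have := ler_norm (enorm (q.1 : 'rV[R]_d) - enorm (y.1 : 'rV[R]_d)); lra.
apply/seteqP; split => // p [np sp]; apply: np; split; first exact: s1.
rewrite -lee_fin (le_trans (V_speed sp))// EFinM; apply: lee_wpmul2l.
  by rewrite lee_fin ltW// CS0.
rewrite EFinD leeD2l//; apply: ge_ereal_sup => _ [q sq <-]; rewrite lee_fin; exact: s1.
Qed.

Lemma V_integral_marginal mu f : bdmeas (f : Rd R d -> R) ->
  \int[V mu]_p f p.1 = \int[mu]_x f x.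
Proof.
move=> bf.
have bfst (g : Rd R d -> R) : bdmeas g -> bdmeas (fun p : (Rd R d * Rd R d)%type => g p.1).
  by move=> bg; exact: (bdmeas_comp measurable_fst bg).
apply: (@eq_positive_linear _ _ (Rd R d) (fun g => \int[V mu]_p g p.1) (fun g => \int[mu]_x g x)) bf.
- split=> [f1 f2 b1 b2|a f1 b1|f1 f2 b1 b2 f12]; cbv beta.
  + by rewrite (RintegralDT (V mu) (bfst _ b1) (bfst _ b2)).
  + by rewrite (RintegralZT (V mu) a (bfst _ b1)).
  + by apply: le_RintegralT => //; exact: bfst.
- exact: positive_linear_Rintegral.
- move=> A mA; cbv beta; rewrite [RHS]Rintegral_indicT// -(V_marginal mu mA) -Rintegral_indicT.
    by apply: eq_Rintegral => p _; rewrite !indicE; congr (nat_of_bool _)%:R; apply/idP/idP;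
      move=> /set_mem H; apply/mem_set.
  by have := @measurable_fst _ _ (Rd R d) (Rd R d) measurableT _ mA; rewrite setTI.
Qed.

Lemma V_mass mu : mass (V mu) = mass mu.
Proof. by rewrite -(V_marginal mu measurableT). Qed.

Lemma s_null mu : s mu (~` @cball0 R d rs) = 0%E.
Proof. by apply: supp_cball_null => x /s_supp /ltW. Qed.

Lemma flat_s mu nu a : 0 <= a -> (flat1 mu nu <= a%:E)%E ->
  (flat1 (s mu) (s nu) <= (Num.max L 0 * a)%:E)%E.
Proof. by move=> a0 mn; exact: (le_flat_scale mB1 mn a0 (s_lip mu nu)). Qed.

(** (S) contains no bound on the mass of the source. Comparison with a fixed reference measure gives
    linear growth. *)
Lemma s_mass mu nu : mass (s mu) <= mass (s nu) + Num.max L 0 * (mass mu + mass nu).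
Proof.
have := flat_s (addr_ge0 (mass_ge0 mu) (mass_ge0 nu)) (flat_le_mass mB1 mu nu).
by move=> /(flat_mass mB1) /(le_trans (ler_norm _)); lra.
Qed.

Lemma c_lip_flat x y mu nu a : (flat1 mu nu <= a%:E)%E ->
  `|c x mu - c y nu| <= CL * (enorm (x - y) + a).
Proof.
move=> mn; rewrite -lee_fin (le_trans (c_lip x y mu nu))// EFinM.
apply: lee_wpmul2l; first by rewrite lee_fin ltW// CL0.
by rewrite EFinD leeD2l.
Qed.

Lemma c_lip_space mu x y : `|c x mu - c y mu| <= CL * enorm (x - y).
Proof. by have := c_lip_flat x y (flat_refl mB1 mu (lexx 0)); rewrite addr0. Qed.

Lemma c_bdmeas mu : bdmeas (fun x : Rd R d => c x mu).
Proof. by apply: (lip_bdmeas mB1 (c_bound ^~ mu)) => x y; exact: c_lip_space. Qed.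

(** A step is described by how its result integrates functions: indicators determine [nu], and the
    estimates use nothing else. *)
Definition euler_rel (h : R) (mu nu : Mplus R d) : Prop :=
  forall f : Rd R d -> R, bdmeas f ->
    \int[nu]_x f x = \int[V mu]_p ((1 + h * c p.1 mu) * f ((p.1 : 'rV[R]_d) + h *: (p.2 : 'rV[R]_d)))
      + h * \int[s mu]_x f x.

(** The source carries the product sigma-algebra. Preimages of open sets are open for [eucl_dist2],
    hence measurable through the countable base. *)
Lemma measurable_drift (h : R) : measurable_fun setT
  (fun p : (Rd R d * Rd R d)%type => ((p.1 : 'rV[R]_d) + h *: (p.2 : 'rV[R]_d) : Rd R d)).
Proof.
move=> _; apply: (@measurability _ _ (Rd R d * Rd R d)%type (Rd R d) _ _ (@open 'rV[R]_d)) => //.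
move=> _ [W oW <-]; rewrite setTI; apply: (base_open_measurable mB2) => p /= Wp.
have : nbhs ((p.1 : 'rV[R]_d) + h *: (p.2 : 'rV[R]_d)) W by exact: open_nbhs_nbhs.
move=> /nbhs_ballP[e /= e0 eW].
have k0 : 0 < 1 + `|h| by rewrite ltr_pwDl.
exists (e / (1 + `|h|)); first by rewrite divr_gt0.
move=> q /=; rewrite ltr_pdivlMr// => pq; apply: eW; rewrite -ball_normE/=.
apply: le_lt_trans (mx_norm_le_enorm _) _; apply: le_lt_trans pq.
rewrite opprD addrACA -scalerBr (le_trans (enormD _ _))// mulrDr mulr1 enormZ lerD//.
  exact: eucl_dist_fst_le.
by rewrite mulrC ler_wpM2r//; exact: eucl_dist_snd_le.
Qed.

Lemma bdmeas_weight h mu : bdmeas (fun p : (Rd R d * Rd R d)%type => 1 + h * c p.1 mu).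
Proof.
apply: bdmeasD; first exact: bdmeas_cst.
by apply: bdmeasZ; exact: (bdmeas_comp measurable_fst (c_bdmeas mu)).
Qed.

Lemma bdmeas_drift h f : bdmeas (f : Rd R d -> R) ->
  bdmeas (fun p : (Rd R d * Rd R d)%type => f ((p.1 : 'rV[R]_d) + h *: (p.2 : 'rV[R]_d))).
Proof. by move=> bf; exact: (bdmeas_comp (measurable_drift h) bf). Qed.

(** The restriction on the step keeps the new measure nonnegative although [c] may be negative. *)
Lemma weight_ge0 h mu x : 0 <= h -> h * Cb <= 1 -> 0 <= 1 + h * c x mu.
Proof.
move=> h0 hb; have := c_bound x mu; rewrite ler_norml => /andP[cb _].
by have := ler_wpM2l h0 cb; rewrite mulrN; lra.
Qed.

Lemma euler_step h mu : 0 <= h -> h * Cb <= 1 -> exists nu, euler_rel h mu nu.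
Proof.
move=> h0 hb; have w0 p : 0 <= 1 + h * c p.1 mu by exact: weight_ge0.
by have [nu Hnu] := weighted_pushforward (V mu) (s mu) (measurable_drift h) (bdmeas_weight h mu) w0 h0; exists nu.
Qed.

(** * Support, mass and displacement in one Euler step *)

Section OneStep.
Variables (h r : R) (mu nu : Mplus R d).
Hypothesis h0 : 0 <= h.
Hypothesis hb : h * Cb <= 1.
Hypothesis mu0 : mu (~` @cball0 R d r) = 0%E.
Hypothesis E : euler_rel h mu nu.

(** Test with the indicator of the complement: from [phase_set r] no mass travels farther than
    [h * (CS * (1 + r))], and sources lie within radius [rs]. *)
Lemma euler_supp : rs <= r -> 0 <= r -> nu (~` @cball0 R d (r + h * (CS * (1 + r)))) = 0%E.
Proof.
move=> rsr r0; set r' := r + _.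
have mC := measurableC (measurable_cball r').
have r'r : r <= r' by rewrite lerDl mulr_ge0// mulr_ge0// ?(ltW CS0)// addr_ge0.
have bI := @bdmeas_indic R _ _ _ mC.
have := E bI; rewrite !Rintegral_indicT//.
have -> : s mu (~` @cball0 R d r') = 0%E.
  apply/eqP; rewrite eq_le measure_ge0 andbT -(s_null mu) le_measure ?inE//.
    exact: measurableC (measurable_cball rs).
  by move=> x /= nx xs; apply: nx; rewrite /cball0 /= (le_trans xs)// (le_trans rsr).
rewrite mulr0 addr0 (_ : Rintegral _ _ _ = 0).
  by move=> n0; rewrite -[LHS]fineK ?n0// fin_num_measure.
rewrite (@eq_Rintegral_ae _ _ _ _ _ (cst 0) _ (measurable_phase_set r) (V_phase_set mu0)).
- by rewrite Rintegral_cstT mul0r.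
- by case: (bdmeasM (bdmeas_weight h mu) (bdmeas_drift h bI)).
- exact: measurable_cst.
- move=> p [p1 p2]; rewrite indicE memNset ?mulr0// => np; apply: np; rewrite /cball0 /=.
  by rewrite (le_trans (enormD _ _))// enormZ ger0_norm// lerD// ler_wpM2l.
Qed.

Lemma euler_mass : mass nu <= (1 + h * Cb) * mass mu + h * mass (s mu).
Proof.
have := E (bdmeas_cst (Rd R d) (1 : R)); rewrite !Rintegral_cstT !mul1r => ->.
rewrite lerD2r -V_mass -Rintegral_cstT; apply: le_RintegralT.
- by apply: bdmeasM; [exact: bdmeas_weight|exact: bdmeas_cst].
- exact: bdmeas_cst.
- move=> p; rewrite mulr1 lerD2l ler_wpM2l//.
  by rewrite (le_trans (ler_norm _))// c_bound.
Qed.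

(** Three contributions of order [h]: displacement at speed at most [CS * (1 + r)], reweighting at
    rate at most [Cb], and the added source. *)
Lemma euler_flat M : 0 <= r -> mass mu <= M ->
  (flat1 mu nu <= (h * ((CS * (1 + r) + Cb) * M + mass (s mu)))%:E)%E.
Proof.
move=> r0 muM; apply/(flat_leP mB1) => psi bp; have [p1 p2] := bp.
have bpsi := BL1_bdmeas mB1 bp; rewrite distrC (E bpsi) -(V_integral_marginal mu bpsi).
have v0 : 0 <= CS * (1 + r) + Cb by rewrite addr_ge0 ?(ltW Cb0)// mulr_ge0 ?(ltW CS0)// addr_ge0.
set I1 := Rintegral _ _ _; set I2 := Rintegral (s mu) _ _; set I3 := Rintegral _ _ _.
have B1 : `|I1 - I3| <= h * (CS * (1 + r) + Cb) * M.
  apply: (@le_trans _ _ (h * (CS * (1 + r) + Cb) * mass (V mu))); last first.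
    by rewrite V_mass ler_wpM2l// mulr_ge0.
  apply: (Rintegral_dist_le (measurable_phase_set r) (V_phase_set mu0)).
  - exact: (bdmeasM (bdmeas_weight h mu) (bdmeas_drift h bpsi)).
  - exact: (bdmeas_comp measurable_fst bpsi).
  - by rewrite mulr_ge0.
  move=> p [q1 q2]; set y : Rd R d := _ + h *: _.
  have l1 : `|psi y - psi p.1| <= h * (CS * (1 + r)).
    apply: (le_trans (p2 _ _)); rewrite /eucl_dist /y [_ + h *: _]addrC addrK enormZ ger0_norm//.
    by rewrite ler_wpM2l.
  have l2 : `|h * c p.1 mu * psi y| <= h * Cb.
    rewrite -mulrA normrM (ger0_norm h0) ler_wpM2l// normrM -[leRHS]mulr1.
    by rewrite ler_pM.
  rewrite (_ : _ - _ = (psi y - psi p.1) + h * c p.1 mu * psi y); last by ring.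
  by rewrite (le_trans (ler_normD _ _))// mulrDr lerD.
have B2 : `|h * I2| <= h * mass (s mu).
  rewrite normrM (ger0_norm h0) ler_wpM2l//.
  by have := Rintegral_norm_le (s mu) bpsi p1; rewrite mul1r.
rewrite (_ : _ - _ = (I1 - I3) + h * I2); last by ring.
by rewrite (le_trans (ler_normD _ _))// mulrDr mulrA lerD.
Qed.

End OneStep.

(** * Rates of change against a test function, and consistency of a step *)

Section Rates.
Variables (f : 'rV[R]_d -> R) (C : R).
Hypothesis C0 : 0 < C.
Hypothesis f_bound : forall x, `|f x| <= C.
Hypothesis f_lip : forall x y, `|f x - f y| <= C * enorm (x - y).
Hypothesis df_bound : forall i x, `|'D_(ei R i) f x| <= C.
Hypothesis df_lip : forall i x y, `|'D_(ei R i) f x - 'D_(ei R i) f y| <= C * enorm (x - y).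
Hypothesis f_taylor : forall x y, `|f (x + y) - f x - grad_dot f x y| <= C * enorm y ^+ 2.

Definition transport_rate mu := \int[V mu]_p grad_dot f p.1 p.2.
Definition growth_rate mu := \int[mu]_x (f x * c x mu).
Definition source_rate mu := \int[s mu]_x f x.

Lemma f_bdmeas : bdmeas (f : Rd R d -> R).
Proof. exact: (lip_bdmeas mB1 f_bound f_lip). Qed.

Lemma growth_lip mu (x y : Rd R d) :
  `|f x * c x mu - f y * c y mu| <= C * (Cb + CL) * eucl_dist x y.
Proof.
rewrite (_ : _ - _ = (f x - f y) * c x mu + f y * (c x mu - c y mu)); last by ring.
rewrite (le_trans (ler_normD _ _))// !normrM mulrDr [leRHS]mulrDl lerD//.
  by rewrite mulrAC ler_pM//; exact: f_lip.
by rewrite -mulrA ler_pM//; exact: c_lip_space.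
Qed.

Lemma growth_bound mu x : `|f x * c x mu| <= C * Cb.
Proof. by rewrite normrM ler_pM. Qed.

Lemma growth_bdmeas mu : bdmeas (fun x : Rd R d => f x * c x mu).
Proof. exact: (bdmeasM f_bdmeas (c_bdmeas mu)). Qed.

Lemma growth_rate_lip mu nu M a : mass mu <= M -> 0 <= a -> (flat1 mu nu <= a%:E)%E ->
  `|growth_rate mu - growth_rate nu| <= C * (CL * M + (Cb + CL)) * a.
Proof.
move=> muM a0 mn; rewrite /growth_rate.
(* The measure occurs twice: it is changed first inside [c], then as the integrator, where the
   integrand is bounded and Lipschitz. *)
have h1 : `|\int[mu]_x (f x * c x mu) - \int[mu]_x (f x * c x nu)| <= C * (CL * a) * M.
  apply: (@le_trans _ _ (C * (CL * a) * mass mu)); last first.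
    by rewrite ler_wpM2l// !mulr_ge0// ltW.
  apply: (Rintegral_dist_le (@measurableT _ (Rd R d))).
  - by rewrite setCT measure0.
  - exact: growth_bdmeas.
  - exact: (bdmeasM f_bdmeas (c_bdmeas nu)).
  - by rewrite !mulr_ge0// ltW.
  move=> x _; rewrite -mulrBr normrM ler_pM//.
  by have := c_lip_flat x x mn; rewrite subrr enorm0 add0r.
have h2 : `|\int[mu]_x (f x * c x nu) - \int[nu]_x (f x * c x nu)| <= C * (Cb + CL) * a.
  apply: (flat_BL mB1 _ _ _ mn).
  - by rewrite mulr_gt0// addr_gt0.
  - move=> x; rewrite (le_trans (growth_bound nu x))// mulrDr lerDl mulr_ge0// ltW//.
  - exact: growth_lip.
have := ler_distD (\int[mu]_x (f x * c x nu)) (\int[mu]_x (f x * c x mu)) (\int[nu]_x (f x * c x nu)).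
move: h1 h2; lra.
Qed.

Lemma source_rate_lip mu nu a : 0 <= a -> (flat1 mu nu <= a%:E)%E ->
  `|source_rate mu - source_rate nu| <= C * (Num.max L 0 * a).
Proof. by move=> a0 mn; apply: (flat_BL mB1 _ _ _ (flat_s a0 mn)) => //; exact: f_lip. Qed.

Definition clip (a t : R) := if t < - a then - a else if a < t then a else t.

Lemma clip_bound a t : 0 <= a -> `|clip a t| <= a.
Proof.
move=> a0; rewrite /clip ler_norml; case: ltP => ?; [|case: ltP => ?];
  by apply/andP; split; lra.
Qed.

Lemma clip_lip a t u : 0 <= a -> `|clip a t - clip a u| <= `|t - u|.
Proof.
move=> a0; have h1 := ler_norm (t - u); have := ler_norm (u - t); rewrite distrC => h2.
rewrite /clip ler_norml; case: (ltP t (- a)) => ?; case: (ltP u (- a)) => ?;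
  case: (ltP a t) => ?; case: (ltP a u) => ?; by apply/andP; split; lra.
Qed.

Lemma clip_id a t : `|t| <= a -> clip a t = t.
Proof. by rewrite ler_norml /clip !ltNge => /andP[-> ->]. Qed.

(* [grad_dot f] with velocities clipped to the range allowed over the ball of radius [r]:
   it has the same integral against [V mu], but is globally bounded and Lipschitz. *)
Definition clipped_grad r p :=
  \sum_(i < d) 'D_(ei R i) f p.1 * clip (CS * (1 + r)) ((p.2 : 'rV[R]_d) ord0 i).

Lemma speed_ge0 r : 0 <= r -> 0 <= CS * (1 + r).
Proof. by move=> r0; rewrite mulr_ge0 ?(ltW CS0)// addr_ge0. Qed.

Lemma clipped_grad_bound r p : 0 <= r -> `|clipped_grad r p| <= d%:R * (C * (CS * (1 + r))).
Proof.
move=> r0; rewrite (le_trans (ler_norm_sum _ _ _))//.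
rewrite -[X in _ <= X%:R * _]card_ord -sum1_card natr_sum mulr_suml.
by apply: ler_sum => i _; rewrite mul1r normrM ler_pM// clip_bound// speed_ge0.
Qed.

Lemma clipped_grad_lip r p q : 0 <= r ->
  `|clipped_grad r p - clipped_grad r q| <= d%:R * (C * (CS * (1 + r)) + C) * eucl_dist2 p q.
Proof.
move=> r0; rewrite -sumrB (le_trans (ler_norm_sum _ _ _))//.
rewrite -mulrA -[X in _ <= X%:R * _]card_ord -sum1_card natr_sum mulr_suml.
apply: ler_sum => i _; rewrite mul1r.
set a := 'D_(ei R i) f p.1; set a' := 'D_(ei R i) f q.1; set b := clip _ _; set b' := clip _ _.
rewrite (_ : _ - _ = (a - a') * b + a' * (b - b')); last by ring.
rewrite (le_trans (ler_normD _ _))// [leRHS]mulrDl !normrM lerD//.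
  rewrite mulrAC ler_pM//; last by rewrite clip_bound// speed_ge0.
  by rewrite (le_trans (df_lip i _ _))// ler_wpM2l ?(ltW C0)//; exact: eucl_dist_fst_le.
apply: ler_pM => //; first exact: df_bound.
rewrite (le_trans (clip_lip _ _ (speed_ge0 r0)))// (le_trans _ (eucl_dist_snd_le p q))//.
have := coord_le_enorm ((p.2 : 'rV[R]_d) - (q.2 : 'rV[R]_d)) i; rewrite !mxE; exact.
Qed.

Lemma clipped_grad_bdmeas r : 0 <= r -> bdmeas (clipped_grad r).
Proof.
move=> r0; apply: (lip_bdmeas mB2 (fun p => clipped_grad_bound p r0)) => p q.
exact: clipped_grad_lip.
Qed.

Lemma transport_rateE mu r : 0 <= r -> mu (~` @cball0 R d r) = 0%E ->
  transport_rate mu = \int[V mu]_p clipped_grad r p.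
Proof.
move=> r0 mu0; apply: (eq_Rintegral_ae (measurable_phase_set r) (V_phase_set mu0)).
- rewrite /grad_dot; apply: measurable_sum => i; apply: measurable_funM.
    apply: (base_lip_measurable mB2 (k := C)) => p q; rewrite (le_trans (df_lip i _ _))//.
    by rewrite ler_wpM2l ?(ltW C0)//; exact: eucl_dist_fst_le.
  apply: (base_lip_measurable mB2 (k := 1)) => p q; rewrite mul1r.
  rewrite (le_trans _ (eucl_dist_snd_le p q))//.
  have := coord_le_enorm ((p.2 : 'rV[R]_d) - (q.2 : 'rV[R]_d)) i; rewrite !mxE; exact.
- by case: (clipped_grad_bdmeas r0).
- move=> p [_ p2]; apply: eq_bigr => i _; rewrite clip_id//.
  by rewrite (le_trans (coord_le_enorm _ _)).
Qed.

Lemma transport_rate_lip r : 0 <= r -> exists2 Q, 0 <= Q & forall mu nu a,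
  mu (~` @cball0 R d r) = 0%E -> nu (~` @cball0 R d r) = 0%E -> 0 <= a ->
  (flat1 mu nu <= a%:E)%E -> `|transport_rate mu - transport_rate nu| <= Q * a.
Proof.
move=> r0; have r1 : 0 < r + 1 by rewrite ltr_wpDl.
(* (V2) speaks of open balls of positive radius, while the supports lie in a closed ball whose
   radius may be 0. *)
have [CF HCF] := V_lip r1.
have K0 : 0 <= C * (CS * (1 + r)) by rewrite mulr_ge0 ?speed_ge0// ltW.
(* The added 1 gives [flat_BL] a positive constant even when [d] is 0. *)
pose K := d%:R * (C * (CS * (1 + r)) + C) + 1.
have K1 : 0 < K by rewrite ltr_wpDl// mulr_ge0// addr_ge0// ltW.
exists (K * Num.max CF 0); first by rewrite mulr_ge0// ?(ltW K1)// le_max lexx orbT.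
move=> mu nu a mu0 nu0 a0 mn.
have sub (rho : Mplus R d) : rho (~` @cball0 R d r) = 0%E -> supp (@eucl_dist R d) rho `<=` @Defs.ball0 R d (r + 1).
  by move=> rho0 x /(null_supp_cball rho0) xr; rewrite /Defs.ball0 /= (le_lt_trans xr)// ltrDl.
have fV := le_flat_scale mB1 mn a0 (HCF mu nu (sub _ mu0) (sub _ nu0)).
rewrite (transport_rateE r0 mu0) (transport_rateE r0 nu0) -mulrA.
apply: (flat_BL mB2 K1 _ _ fV) => [p|p q].
  rewrite (le_trans (clipped_grad_bound p r0))// /K [X in _ <= X + 1]mulrDr -addrA lerDl addr_ge0//.
  by rewrite mulr_ge0// ltW.
by rewrite (le_trans (clipped_grad_lip p q r0))// ler_wpM2r ?eucl_dist2_ge0// /K lerDl.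
Qed.

(** Local truncation error. One part is the Taylor remainder for a displacement at most [h * v]; the
    other arises because the weight multiplies [f] at the moved point while [growth_rate] uses the
    old one. *)
Lemma euler_taylor h r mu nu : 0 <= h -> 0 <= r -> mu (~` @cball0 R d r) = 0%E ->
  euler_rel h mu nu ->
  `|\int[nu]_x f x - \int[mu]_x f x - h * (transport_rate mu + growth_rate mu + source_rate mu)|
    <= h ^+ 2 * (C * (CS * (1 + r)) ^+ 2 + Cb * (C * (CS * (1 + r)))) * mass mu.
Proof.
move=> h0 r0 mu0 E; have bf := f_bdmeas; set v := CS * (1 + r).
have v0 : 0 <= v := speed_ge0 r0.
rewrite (E _ bf) -(V_integral_marginal mu bf) (transport_rateE r0 mu0).
have b1 : bdmeas (fun p : (Rd R d * Rd R d)%type => f p.1) by exact: (bdmeas_comp measurable_fst bf).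
have b2 : bdmeas (fun p : (Rd R d * Rd R d)%type => f p.1 * c p.1 mu).
  exact: (bdmeas_comp measurable_fst (growth_bdmeas mu)).
have b3 := clipped_grad_bdmeas r0.
rewrite /growth_rate -(V_integral_marginal mu (growth_bdmeas mu)).
set I1 := Rintegral _ _ _; set I2 := Rintegral _ _ _; set I3 := Rintegral _ _ _.
set I4 := Rintegral _ _ _; set I5 := Rintegral _ _ _.
have -> : I1 + h * I2 - I3 - h * (I4 + I5 + source_rate mu) = I1 - (I3 + h * (I4 + I5)).
  by rewrite /source_rate -/I2; ring.
have -> : I3 + h * (I4 + I5) =
    \int[V mu]_p (f p.1 + h * (clipped_grad r p + f p.1 * c p.1 mu)).
  by rewrite (RintegralDT _ b1 (bdmeasZ h (bdmeasD b3 b2))) (RintegralZT _ _ (bdmeasD b3 b2))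
    (RintegralDT _ b3 b2).
rewrite -[in leRHS](V_mass mu).
apply: (Rintegral_dist_le (measurable_phase_set r) (V_phase_set mu0)).
- exact: (bdmeasM (bdmeas_weight h mu) (bdmeas_drift h bf)).
- exact: (bdmeasD b1 (bdmeasZ h (bdmeasD b3 b2))).
- by rewrite mulr_ge0 ?sqr_ge0// addr_ge0// mulr_ge0 ?sqr_ge0 ?(ltW Cb0) ?(ltW C0)// mulr_ge0// ltW.
move=> p [p1 p2].
have -> : clipped_grad r p = grad_dot f p.1 p.2.
  apply: eq_bigr => i _; rewrite clip_id//.
  by rewrite (le_trans (coord_le_enorm _ _)).
set x : 'rV[R]_d := p.1; set y : 'rV[R]_d := p.2.
have gh : grad_dot f x (h *: y) = h * grad_dot f x y.
  by rewrite /grad_dot mulr_sumr; apply: eq_bigr => i _; rewrite mxE mulrCA.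
have hy : enorm (h *: y) <= h * v by rewrite enormZ ger0_norm// ler_wpM2l.
rewrite (_ : _ - _ = (f (x + h *: y) - f x - grad_dot f x (h *: y)) +
    h * (c x mu * (f (x + h *: y) - f x))); last by rewrite gh /=; ring.
rewrite (le_trans (ler_normD _ _))// [leRHS]mulrDr lerD//.
  apply: (le_trans (f_taylor _ _)); rewrite [leRHS]mulrCA ler_wpM2l ?(ltW C0)// -exprMn.
  by rewrite lerXn2r// ?nnegrE ?enorm_ge0// mulr_ge0.
rewrite normrM (ger0_norm h0) expr2 -mulrA ler_wpM2l// normrM.
rewrite (_ : h * _ = Cb * (C * (h * v))); last by ring.
rewrite ler_pM// (le_trans (f_lip _ _))// ler_wpM2l ?(ltW C0)//.
by rewrite [x + _]addrC addrK.
Qed.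

End Rates.

(** The cap [e <= 1] lets quadratic errors in [e] be absorbed into [Q * e]. *)
Lemma le_of_small_error (x y Q : R) :
  (forall e, 0 < e -> e <= 1 -> x <= y + Q * e) -> x <= y.
Proof.
move=> H; apply/ler_addgt0Pr => e e0; have Q1 : 0 < `|Q| + 1 by rewrite ltr_wpDl.
have e1 : 0 < Num.min 1 (e / (`|Q| + 1)) by rewrite lt_min ltr01 divr_gt0.
apply: (le_trans (H _ e1 _)); first by rewrite ge_min lexx.
rewrite lerD2l; apply: (@le_trans _ _ ((`|Q| + 1) * Num.min 1 (e / (`|Q| + 1)))).
  by rewrite ler_wpM2r ?(ltW e1)// (le_trans (ler_norm Q))// lerDl.
rewrite mulrC -ler_pdivlMr// ge_min; apply/orP; right; exact: lexx.
Qed.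

Lemma pow_le_expR (a h T : R) k : 0 <= a -> 0 <= h -> k%:R * h <= T ->
  (1 + h * a) ^+ k <= expR (a * T).
Proof.
move=> a0 h0 kT; apply: (@le_trans _ _ (expR (h * a) ^+ k)).
  by rewrite lerXn2r ?nnegrE ?expR_ge0 ?expR_ge1Dx// addr_ge0// mulr_ge0.
by rewrite -expRM_natl ler_expR mulrA mulrC ler_wpM2l.
Qed.

(** * Bounds for the iterated scheme uniform in the step, and its limit *)

Section Iteration.
Variables (T r0 : R) (mu0 : Mplus R d).
Hypothesis T0 : 0 < T.
Hypothesis r00 : 0 <= r0.
Hypothesis rs_r0 : rs <= r0.
Hypothesis mu0_supp : mu0 (~` @cball0 R d r0) = 0%E.

(** Discrete Gronwall constants. As [mass (s mu)] is at most [B + L0 * mass mu], each step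
    multiplies [mass + B] by at most [1 + h * A], the 1 in [A] absorbing [h * B]; likewise one plus
    the radius is multiplied by [1 + h * CS]. Exponentials bound these products up to time [T],
    giving [M] and [rho]; [lip_time] is the rate in [euler_flat] under these bounds. *)
Let L0 := Num.max L 0.
Let A := Cb + L0 + 1.
Let B := mass (s mu0) + L0 * mass mu0.
Let rho := (1 + r0) * expR (CS * T) - 1.
Let M := (mass mu0 + B) * expR (A * T).
Let lip_time := (CS * (1 + rho) + Cb) * M + (B + L0 * M).

Let L00 : 0 <= L0. Proof. by rewrite le_max lexx orbT. Qed.
Let A0 : 0 <= A. Proof. by rewrite addr_ge0// addr_ge0// ltW. Qed.
Let B0 : 0 <= B. Proof. by rewrite addr_ge0 ?mulr_ge0 ?mass_ge0. Qed.
Let M0 : 0 <= M. Proof. by rewrite mulr_ge0 ?expR_ge0// addr_ge0 ?mass_ge0. Qed.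

Let r0_rho : r0 <= rho.
Proof.
have h1 : 1 <= expR (CS * T) by rewrite -expR0 ler_expR mulr_ge0 ?(ltW T0)// ltW.
have r1 : 0 <= 1 + r0 by rewrite addr_ge0.
by rewrite /rho; have := ler_wpM2l r1 h1; lra.
Qed.

Let rho0 : 0 <= rho. Proof. exact: le_trans r0_rho. Qed.

Lemma lip_time_ge0 : 0 <= lip_time.
Proof.
rewrite addr_ge0//; last by rewrite addr_ge0// mulr_ge0.
by rewrite mulr_ge0// addr_ge0 ?speed_ge0// ltW.
Qed.

Definition euler_bounded mu := mu (~` @cball0 R d rho) = 0%E /\ mass mu <= M.

Let null_mono mu r r' : r <= r' -> mu (~` @cball0 R d r) = 0%E -> mu (~` @cball0 R d r') = 0%E.
Proof.
move=> rr mr; apply/eqP; rewrite eq_le measure_ge0 andbT -mr le_measure ?inE//.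
- exact: measurableC (measurable_cball r').
- exact: measurableC (measurable_cball r).
- by move=> x nx xr; apply: nx; exact: (le_trans xr).
Qed.

Let s_mass_le mu : mass (s mu) <= B + L0 * mass mu.
Proof. by have := s_mass mu mu0; rewrite -/L0 /B; lra. Qed.

Lemma euler_bounded_init : euler_bounded mu0.
Proof.
split; first exact: null_mono r0_rho mu0_supp.
have h1 : 1 <= expR (A * T) by rewrite -expR0 ler_expR mulr_ge0// ltW.
apply: (@le_trans _ _ (mass mu0 + B)); first by rewrite lerDl.
by rewrite ler_peMr// addr_ge0 ?mass_ge0.
Qed.

Section Scheme.
Variables (h : R) (E : nat -> Mplus R d).
Hypothesis h0 : 0 < h.
Hypothesis E0 : E 0%N = mu0.
Hypothesis ES : forall k, euler_rel h (E k) (E k.+1).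

Lemma scheme_supp k : E k (~` @cball0 R d ((1 + r0) * (1 + h * CS) ^+ k - 1)) = 0%E.
Proof.
elim: k => [|k IH]; first by rewrite expr0 mulr1 addrC addKr E0.
have h1 : 1 <= (1 + h * CS) ^+ k by rewrite exprn_ege1// lerDl mulr_ge0// ltW.
have r1 : 0 <= 1 + r0 by rewrite addr_ge0.
have rr : r0 <= (1 + r0) * (1 + h * CS) ^+ k - 1 by have := ler_wpM2l r1 h1; lra.
have := euler_supp (ltW h0) IH (@ES k) (le_trans rs_r0 rr) (le_trans r00 rr).
by congr (E _ (~` cball0 _) = _); rewrite exprS; ring.
Qed.

Lemma scheme_mass k : mass (E k) + B <= (mass mu0 + B) * (1 + h * A) ^+ k.
Proof.
elim: k => [|k IH]; first by rewrite expr0 mulr1 E0.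
have hA : 0 <= 1 + h * A by rewrite addr_ge0// mulr_ge0// ltW.
rewrite exprSr mulrA; apply: le_trans (ler_wpM2r hA IH).
have := euler_mass (ltW h0) (@ES k); have := ler_wpM2l (ltW h0) (s_mass_le (E k)).
have := mulr_ge0 (ltW h0) (mass_ge0 (E k)); have := mulr_ge0 (ltW h0) B0.
have := mulr_ge0 (mulr_ge0 (ltW h0) B0) L00; have := mulr_ge0 (mulr_ge0 (ltW h0) B0) (ltW Cb0).
rewrite /A; lra.
Qed.

Lemma scheme_bounded k : k%:R * h <= T -> euler_bounded (E k).
Proof.
move=> kT; split.
  apply: null_mono (scheme_supp k); rewrite lerB// ler_wpM2l ?addr_ge0//.
  exact: (pow_le_expR (ltW CS0) (ltW h0) kT).
apply: (@le_trans _ _ (mass (E k) + B)); first by rewrite lerDl.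
apply: (le_trans (scheme_mass k)); apply: ler_wpM2l; first exact: addr_ge0 (mass_ge0 _) B0.
exact: (pow_le_expR A0 (ltW h0) kT).
Qed.

Let index_le j n : (j + n)%:R * h <= T -> j%:R * h <= T.
Proof. by apply: le_trans; rewrite ler_wpM2r ?(ltW h0)// ler_nat leq_addr. Qed.

Lemma scheme_lip j n : (j + n)%:R * h <= T ->
  (flat1 (E j) (E (j + n)) <= (n%:R * h * lip_time)%:E)%E.
Proof.
elim: n => [|n IH] jn; first by rewrite addn0 !mul0r; exact: (flat_refl mB1).
have jn' : (j + n)%:R * h <= T by apply: le_trans jn; rewrite ler_wpM2r ?(ltW h0)// ler_nat leq_add2l.
have [nE mE] := scheme_bounded jn'.
have h1 := euler_flat (ltW h0) nE (@ES (j + n)) rho0 mE.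
rewrite addnS; have := flat_triangle mB1 (IH jn') h1; move/le_trans; apply.
have h2 : (CS * (1 + rho) + Cb) * M + mass (s (E (j + n))) <= lip_time.
  by rewrite lerD2l (le_trans (s_mass_le _))// lerD2l ler_wpM2l.
by rewrite lee_fin -(natr1 n); have := ler_wpM2l (ltW h0) h2; lra.
Qed.

Section SchemeRates.
Variables (f : 'rV[R]_d -> R) (C Q : R).
Hypothesis C0 : 0 < C.
Hypothesis f_bound : forall x, `|f x| <= C.
Hypothesis f_lip : forall x y, `|f x - f y| <= C * enorm (x - y).
Hypothesis df_bound : forall i x, `|'D_(ei R i) f x| <= C.
Hypothesis df_lip : forall i x y, `|'D_(ei R i) f x - 'D_(ei R i) f y| <= C * enorm (x - y).
Hypothesis f_taylor : forall x y, `|f (x + y) - f x - grad_dot f x y| <= C * enorm y ^+ 2.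

Let G mu := transport_rate f mu + growth_rate f mu + source_rate f mu.
Hypothesis Q0 : 0 <= Q.
Hypothesis G_lip : forall mu nu a, euler_bounded mu -> euler_bounded nu -> 0 <= a ->
  (flat1 mu nu <= a%:E)%E -> `|G mu - G nu| <= Q * a.

Definition scheme_error : R :=
  (C * (CS * (1 + rho)) ^+ 2 + Cb * (C * (CS * (1 + rho)))) * M.

Let coef_ge0 : 0 <= C * (CS * (1 + rho)) ^+ 2 + Cb * (C * (CS * (1 + rho))).
Proof.
have v0 := speed_ge0 rho0; apply: addr_ge0; first by rewrite mulr_ge0 ?sqr_ge0 ?(ltW C0).
by apply: mulr_ge0; [exact: ltW|apply: mulr_ge0 => //; exact: ltW].
Qed.

Lemma scheme_error_ge0 : 0 <= scheme_error.
Proof. exact: mulr_ge0 coef_ge0 M0. Qed.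

(** The [n] truncation errors of order [h ^+ 2] add up to the first term. Keeping the rate frozen at
    [E j] costs the second: after [n] steps the iterate has moved by at most
    [n%:R * h * lip_time]. *)
Lemma scheme_rate j n : (j + n)%:R * h <= T ->
  `|\int[E (j + n)]_x f x - \int[E j]_x f x - n%:R * h * G (E j)| <=
    n%:R * h * h * scheme_error + Q * lip_time * (n%:R * h) ^+ 2.
Proof.
elim: n => [|n IH] jn; first by rewrite addn0 !mul0r subrr subr0 normr0 expr0n/= mulr0 addr0.
have jn' : (j + n)%:R * h <= T by apply: le_trans jn; rewrite ler_wpM2r ?(ltW h0)// ler_nat leq_add2l.
have bE := scheme_bounded jn'; have bj := scheme_bounded (index_le jn).
have [nE mE] := bE.
have h1 := euler_taylor C0 f_bound f_lip df_bound df_lip f_taylor (ltW h0) rho0 nE (@ES (j + n)).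
have nh0 : 0 <= n%:R * h by rewrite mulr_ge0// ltW.
have a0 : 0 <= n%:R * h * lip_time by rewrite mulr_ge0// lip_time_ge0.
have h2 := G_lip bE bj a0 (flat_sym mB1 (scheme_lip jn')).
have h3 := IH jn'.
have h4 : `|h * (G (E (j + n)) - G (E j))| <= h * (Q * (n%:R * h * lip_time)).
  by rewrite normrM (gtr0_norm h0) ler_wpM2l// ltW.
have h5 : h ^+ 2 * (C * (CS * (1 + rho)) ^+ 2 + Cb * (C * (CS * (1 + rho)))) * mass (E (j + n))
    <= h ^+ 2 * scheme_error.
  by rewrite -mulrA ler_wpM2l ?sqr_ge0// /scheme_error ler_wpM2l.
rewrite -/(G _) in h1; rewrite addnS.
rewrite (_ : _ - _ - _ = (\int[E (j + n)]_x f x - \int[E j]_x f x - n%:R * h * G (E j)) +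
   ((\int[E (j + n).+1]_x f x - \int[E (j + n)]_x f x - h * G (E (j + n))) +
    h * (G (E (j + n)) - G (E j)))); last by rewrite -natr1; ring.
rewrite (le_trans (ler_normD _ _))//.
have := ler_normD (\int[E (j + n).+1]_x f x - \int[E (j + n)]_x f x - h * G (E (j + n)))
   (h * (G (E (j + n)) - G (E j))).
have h6 : 0 <= Q * lip_time * (n%:R * h * h + h ^+ 2).
  by rewrite !mulr_ge0 ?lip_time_ge0// addr_ge0 ?sqr_ge0// mulr_ge0// ltW.
have := le_trans h1 h5; rewrite -(natr1 n); move: h3 h4 h6.
lra.
Qed.

End SchemeRates.
End Scheme.

(** Sets of the ultrafilter intersect, so one step serves both times; increments of the limit can
    then be compared with those of a single scheme. *)
Lemma euler_limit : exists mu : R -> Mplus R d,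
  (forall t, 0 <= t <= T -> euler_bounded (mu t)) /\
  (forall t t', 0 <= t <= T -> 0 <= t' <= T -> forall e, 0 < e -> exists h (E : nat -> Mplus R d),
    [/\ 0 < h <= e, h * Cb <= 1, E 0%N = mu0, forall k, euler_rel h (E k) (E k.+1) &
      (flat1 (E (Num.truncn (t / h))) (mu t) <= e%:E)%E /\
      (flat1 (E (Num.truncn (t' / h))) (mu t') <= e%:E)%E]).
Proof.
pose adm h := 0 < h /\ h * Cb <= 1.
have [E HE] : {E : R -> nat -> Mplus R d & forall h, adm h ->
    E h 0%N = mu0 /\ forall k, euler_rel h (E h k) (E h k.+1)}.
  apply: (@choice _ _ (fun h E => adm h ->
    E 0%N = mu0 /\ forall k, euler_rel h (E k) (E k.+1))) => h.
  have [[h0 hb]|nadm] := pselect (adm h); last by exists (fun=> mu0).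
  have [step Hstep] : {step : Mplus R d -> Mplus R d & forall mu, euler_rel h mu (step mu)}.
    by apply: (@choice _ _ (euler_rel h)) => mu; apply: euler_step => //; exact: ltW.
  by exists (fun k => iter k step mu0) => _; split => // k; exact: Hstep.
have [U [UU subU]] := ultraFilterLemma (at_right_proper_filter (0 : R)).
(* [flat_compact] asks for its bounds at every index, hence a bounded default at inadmissible
   steps. *)
pose m t h := if asbool (adm h) then E h (Num.truncn (t / h)) else mu0.
have mb t h : 0 <= t <= T -> euler_bounded (m t h).
  move=> /andP[t0 tT]; rewrite /m; case: asboolP => [[h0 hb]|_]; last exact: euler_bounded_init.
  have [E0 ES] := HE h (conj h0 hb).
  apply: (scheme_bounded h0 E0 ES); apply: le_trans tT.
  have := truncn_le (t / h); rewrite divr_ge0 ?(ltW h0)// => th.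
  by rewrite -ler_pdivlMr.
have [mu Hmu] : {mu : R -> Mplus R d & forall t, 0 <= t <= T -> euler_bounded (mu t) /\
    forall e : R, 0 < e -> U [set h | (flat1 (m t h) (mu t) <= e%:E)%E]}.
  apply: (@choice _ _ (fun t mu => 0 <= t <= T -> euler_bounded mu /\
    forall e : R, 0 < e -> U [set h | (flat1 (m t h) mu <= e%:E)%E])) => t.
  have [tT|] := boolP (0 <= t <= T); last by exists mu0.
  have [mu [mu1 mu2 mu3]] := @flat_compact R d R U UU (m t) rho M
    (fun h => (mb t h tT).1) (fun h => (mb t h tT).2).
  by exists mu.
exists mu; split => [t /Hmu[]//|t t' tT tT' e e0].
have [_ /(_ e e0) U1] := Hmu t tT; have [_ /(_ e e0) U2] := Hmu t' tT'.
have U3 : U [set h | 0 < h <= Num.min e Cb^-1].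
  apply: subU; have d0 : 0 < Num.min e Cb^-1 by rewrite lt_min e0 invr_gt0.
  near=> h; apply/andP; split; first by near: h; exact: nbhs_right_gt.
  by near: h; exact: nbhs_right_le.
have [h [/= h1 [h2 /andP[h0]]]] := filter_ex (filterI U1 (filterI U2 U3)).
rewrite le_min => /andP[he hC].
have hb : h * Cb <= 1 by rewrite -ler_pdivlMr// div1r.
have [E0 ES] := HE h (conj h0 hb).
exists h, (E h); split => //; first by rewrite h0.
by move: h1 h2; rewrite /m asboolT.
Unshelve. all: by end_near. Qed.


(** Rounding both times down leaves errors in [0, h), and these enter the elapsed time with opposite
    signs. *)
Lemma truncn_grid (h t t' : R) : 0 < h -> 0 <= t -> t <= t' -> exists n,
  [/\ Num.truncn (t' / h) = (Num.truncn (t / h) + n)%N, `|n%:R * h - (t' - t)| <= h &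
      (Num.truncn (t / h) + n)%:R * h <= t'].
Proof.
move=> h0 t0 tt; have t'0 := le_trans t0 tt; set k := Num.truncn (t / h).
set k' := Num.truncn (t' / h).
have kk : (k <= k')%N by apply: le_truncn; rewrite ler_pM2r ?invr_gt0.
have := truncn_itv (divr_ge0 t0 (ltW h0)); rewrite -/k => /andP[].
rewrite ler_pdivlMr// ltr_pdivrMr// -natr1 mulrDl mul1r => k1 k2.
have := truncn_itv (divr_ge0 t'0 (ltW h0)); rewrite -/k' => /andP[].
rewrite ler_pdivlMr// ltr_pdivrMr// -natr1 mulrDl mul1r => k3 k4.
exists (k' - k)%N; rewrite subnKC//; split => //.
by rewrite natrB// mulrBl ler_norml; apply/andP; split; lra.
Qed.

(** * Passage to the limit in the step *)

Section Limit.
Variable mu : R -> Mplus R d.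
Hypothesis mu_bounded : forall t, 0 <= t <= T -> euler_bounded (mu t).
Hypothesis mu_limit : forall t t', 0 <= t <= T -> 0 <= t' <= T -> forall e, 0 < e ->
  exists h (E : nat -> Mplus R d),
    [/\ 0 < h <= e, h * Cb <= 1, E 0%N = mu0, forall k, euler_rel h (E k) (E k.+1) &
      (flat1 (E (Num.truncn (t / h))) (mu t) <= e%:E)%E /\
      (flat1 (E (Num.truncn (t' / h))) (mu t') <= e%:E)%E].

Lemma limit_lip t t' : 0 <= t <= T -> 0 <= t' <= T ->
  (flat1 (mu t) (mu t') <= (lip_time * `|t - t'|)%:E)%E.
Proof.
wlog tt' : t t' / t <= t'.
  move=> H tT tT'; have [tt|/ltW tt] := leP t t'; first exact: H.
  by apply: (flat_sym mB1); rewrite distrC; exact: H.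
move=> tT tT'; have /andP[t0 _] := tT; have /andP[_ t'T] := tT'.
have [a _ Ea] := flat_fin mB1 (mu t) (mu t').
rewrite Ea lee_fin distrC ger0_norm ?subr_ge0//.
(* One [e] for the approximation at each time, and [lip_time * e] for rounding the elapsed time to
   the grid. *)
apply: (@le_of_small_error _ _ (lip_time + 2)) => e e0 _.
have [h [E [/andP[h0 he] hb E0 ES [f1 f2]]]] := mu_limit tT tT' e0.
have [n [nE hn nT]] := truncn_grid h0 t0 tt'.
have f3 := scheme_lip h0 E0 ES (le_trans nT t'T); rewrite -nE in f3.
have := flat_triangle mB1 (flat_triangle mB1 (flat_sym mB1 f1) f3) f2.
rewrite Ea lee_fin => /le_trans; apply.
have nh : n%:R * h <= t' - t + e by move: hn; rewrite ler_norml => /andP[_]; lra.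
by have := ler_wpM2r lip_time_ge0 nh; lra.
Qed.

Section LimitRate.
Variables (f : 'rV[R]_d -> R) (C Q : R).
Hypothesis C0 : 0 < C.
Hypothesis f_bound : forall x, `|f x| <= C.
Hypothesis f_lip : forall x y, `|f x - f y| <= C * enorm (x - y).
Hypothesis df_bound : forall i x, `|'D_(ei R i) f x| <= C.
Hypothesis df_lip : forall i x y, `|'D_(ei R i) f x - 'D_(ei R i) f y| <= C * enorm (x - y).
Hypothesis f_taylor : forall x y, `|f (x + y) - f x - grad_dot f x y| <= C * enorm y ^+ 2.
Let G nu := transport_rate f nu + growth_rate f nu + source_rate f nu.
Hypothesis Q0 : 0 <= Q.
Hypothesis G_lip : forall nu nu' a, euler_bounded nu -> euler_bounded nu' -> 0 <= a ->
  (flat1 nu nu' <= a%:E)%E -> `|G nu - G nu'| <= Q * a.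

Lemma limit_rate_le t t' : 0 <= t <= T -> 0 <= t' <= T -> t <= t' ->
  `|\int[mu t']_x f x - \int[mu t]_x f x - (t' - t) * G (mu t)| <=
    Q * lip_time * (t' - t) ^+ 2.
Proof.
move=> tT tT' tt'; have /andP[t0 _] := tT; have /andP[_ t'T] := tT'.
have SE0 : 0 <= scheme_error C by exact: scheme_error_ge0.
have QL : 0 <= Q * lip_time by rewrite mulr_ge0// lip_time_ge0.
(* In order: the two integrals of [f], the truncation errors, the square of [n%:R * h] against that
   of [t' - t], the rate at [E j] against the rate at [mu t], and the elapsed time in front of that
   rate. *)
apply: (@le_of_small_error _ _ (2 * C + (T + 1) * scheme_error C +
  Q * lip_time * (2 * T + 1) + (T + 1) * Q + `|G (mu t)|)) => e e0 e1.
have [h [E [/andP[h0 he] hb E0 ES [f1 f2]]]] := mu_limit tT tT' e0.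
have [n [nE hn nT]] := truncn_grid h0 t0 tt'.
have jT := le_trans nT t'T.
have r1 := scheme_rate h0 E0 ES C0 f_bound f_lip df_bound df_lip f_taylor Q0 G_lip jT.
rewrite -nE in r1; move: r1 f1 f2; set j := Num.truncn (t / h); set k := Num.truncn (t' / h).
move=> r1 f1 f2.
have bj : euler_bounded (E j).
  apply: (scheme_bounded h0 E0 ES); apply: le_trans jT.
  by rewrite ler_wpM2r ?(ltW h0)// ler_nat leq_addr.
have g1 := G_lip bj (mu_bounded tT) (ltW e0) f1.
have i1 := flat_BL mB1 C0 f_bound f_lip f1; have i2 := flat_BL mB1 C0 f_bound f_lip f2.
have T0' : 0 < T := T0.
pose N := n%:R * h; rewrite -/N in hn r1.
rewrite -/(G (E j)) in r1.
have N0 : 0 <= N by rewrite mulr_ge0// ltW.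
have De : N <= t' - t + e by move: hn; rewrite ler_norml => /andP[_]; lra.
have D0 : 0 <= t' - t by rewrite subr_ge0.
have DT : t' - t <= T by lra.
have NT : N <= T + 1 by lra.
have q1 : N * h * scheme_error C <= (T + 1) * e * scheme_error C.
  by rewrite ler_wpM2r// ler_pM// ltW.
have q2 : N ^+ 2 <= (t' - t) ^+ 2 + (2 * T + 1) * e.
  apply: (@le_trans _ _ ((t' - t + e) ^+ 2)); first by rewrite lerXn2r ?nnegrE// addr_ge0// ltW.
  have := ler_wpM2r (ltW e0) DT; have := ler_wpM2r (ltW e0) e1; rewrite !expr2; lra.
have q3 := ler_wpM2l QL q2.
have q4 : `|N * (G (E j) - G (mu t))| <= (T + 1) * (Q * e).
  by rewrite normrM (ger0_norm N0) ler_pM.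
have q5 : `|(N - (t' - t)) * G (mu t)| <= e * `|G (mu t)|.
  by rewrite normrM ler_wpM2r// (le_trans hn).
move: i1 i2 r1 q4 q5; rewrite !ler_norml.
move: (G (mu t)) (G (E j)) `|G (mu t)| => g g' gn.
move=> /andP[? ?] /andP[? ?] /andP[? ?] /andP[? ?] /andP[? ?].
by apply/andP; split; lra.
Qed.

(** A two-sided derivative needs backward increments too. Exchanging the times moves the base point
    of [G] to the other end, which costs a second quadratic term. *)
Lemma limit_rate t t' : 0 <= t <= T -> 0 <= t' <= T ->
  `|\int[mu t']_x f x - \int[mu t]_x f x - (t' - t) * G (mu t)| <=
    2 * (Q * lip_time) * (t' - t) ^+ 2.
Proof.
move=> tT tT'; have QL : 0 <= Q * lip_time by rewrite mulr_ge0// lip_time_ge0.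
have [tt|/ltW tt] := leP t t'.
  apply: (le_trans (limit_rate_le tT tT' tt)).
  by rewrite ler_wpM2r ?sqr_ge0// ler_peMl// ler1n.
have r1 := limit_rate_le tT' tT tt.
have a0 : 0 <= lip_time * `|t' - t| by rewrite mulr_ge0 ?lip_time_ge0.
have g1 := G_lip (mu_bounded tT') (mu_bounded tT) a0 (limit_lip tT' tT).
have q : `|(t' - t) * (G (mu t') - G (mu t))| <= Q * lip_time * (t' - t) ^+ 2.
  rewrite normrM -[in leRHS]real_normK ?num_real// expr2 mulrA mulrC ler_wpM2r//.
  by rewrite -mulrA.
move: r1 q; rewrite !ler_norml (_ : (t - t') ^+ 2 = (t' - t) ^+ 2); last by ring.
by move=> /andP[? ?] /andP[? ?]; apply/andP; split; lra.
Qed.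

End LimitRate.

(** The three rates are estimated separately because the equation has three separate time integrals,
    each of which must be shown integrable. *)
Lemma rates_lip f : test_fun f -> exists2 Q, 0 <= Q &
  forall nu nu' a, euler_bounded nu -> euler_bounded nu' -> 0 <= a ->
  (flat1 nu nu' <= a%:E)%E ->
  [/\ `|transport_rate f nu - transport_rate f nu'| <= Q * a,
      `|growth_rate f nu - growth_rate f nu'| <= Q * a &
      `|source_rate f nu - source_rate f nu'| <= Q * a].
Proof.
move=> /test_fun_bounds[C [C0 [fb fl] [db dl] _]].
have [Q1 Q10 HQ1] := transport_rate_lip C0 db dl rho0.
have Q20 : 0 <= C * (CL * M + (Cb + CL)).
  by rewrite mulr_ge0 ?(ltW C0)// !addr_ge0 ?(ltW Cb0) ?(ltW CL0)// mulr_ge0// ltW.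
have Q30 : 0 <= C * L0 by rewrite mulr_ge0// ltW.
exists (Q1 + C * (CL * M + (Cb + CL)) + C * L0); first by rewrite !addr_ge0.
move=> nu nu' a [b1 m1] [b2 _] a0 H.
have h1 := HQ1 _ _ _ b1 b2 a0 H; have h2 := growth_rate_lip C0 fb fl m1 a0 H.
have h3 := source_rate_lip C0 fb fl a0 H; rewrite -/L0 mulrA in h3.
have := mulr_ge0 Q10 a0; have := mulr_ge0 Q20 a0; have := mulr_ge0 Q30 a0.
by split; lra.
Qed.

Lemma limit_init f : test_fun f -> \int[mu 0]_x f x = \int[mu0]_x f x.
Proof.
move=> /test_fun_bounds[C [C0 [fb fl] _ _]].
apply/eqP; rewrite -subr_eq0 -normr_le0; apply: (@le_of_small_error _ _ C) => e e0 _.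
have h0T : 0 <= (0 : R) <= T by rewrite lexx ltW.
have [h [E [_ _ E0 _ [+ _]]]] := mu_limit h0T h0T e0.
(* At time 0 the scheme sits at index 0, so it equals [mu0] whatever the step. *)
rewrite mul0r truncn0 E0 add0r distrC => H.
exact: (flat_BL mB1 C0 fb fl H).
Qed.

Lemma limit_weak f t : test_fun f -> 0 <= t <= T ->
  \int[mu t]_x f x - \int[mu0]_x f x =
    \int[lebesgue_measure]_(r in [set r : R | 0 <= r <= t]) transport_rate f (mu r)
  + \int[lebesgue_measure]_(r in [set r : R | 0 <= r <= t]) growth_rate f (mu r)
  + \int[lebesgue_measure]_(r in [set r : R | 0 <= r <= t]) source_rate f (mu r).
Proof.
move=> tf tT; have [Q Q0 HQ] := rates_lip tf.
have [C [C0 [fb fl] [db dl] ft]] := test_fun_bounds tf.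
pose G nu := transport_rate f nu + growth_rate f nu + source_rate f nu.
have Q30 : 0 <= 3 * Q by rewrite mulr_ge0.
have G_lip nu nu' a : euler_bounded nu -> euler_bounded nu' -> 0 <= a ->
    (flat1 nu nu' <= a%:E)%E -> `|G nu - G nu'| <= 3 * Q * a.
  move=> b1 b2 a0 H; have [] := HQ _ _ _ b1 b2 a0 H.
  rewrite /G !ler_norml => /andP[? ?] /andP[? ?] /andP[? ?].
  by apply/andP; split; lra.
have key := limit_rate C0 fb fl db dl ft Q30 G_lip.
have lipQ r r' : 0 <= r <= T -> 0 <= r' <= T ->
  [/\ `|transport_rate f (mu r) - transport_rate f (mu r')| <= Q * lip_time * `|r - r'|,
      `|growth_rate f (mu r) - growth_rate f (mu r')| <= Q * lip_time * `|r - r'| &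
      `|source_rate f (mu r) - source_rate f (mu r')| <= Q * lip_time * `|r - r'|].
  move=> rT rT'; rewrite -!mulrA; apply: HQ; try exact: mu_bounded.
    by rewrite mulr_ge0 ?lip_time_ge0.
  exact: limit_lip.
have LQ : 0 <= Q * lip_time by rewrite mulr_ge0 ?lip_time_ge0.
(* [integral_of_quadratic_remainder] takes one constant for both estimates; the larger one, from
   [key], is used here. *)
have lipG r r' : 0 <= r <= T -> 0 <= r' <= T ->
    `|G (mu r) - G (mu r')| <= 2 * (3 * Q * lip_time) * `|r - r'|.
  move=> rT rT'; have [] := lipQ r r' rT rT'; have := mulr_ge0 LQ (normr_ge0 (r - r')).
  rewrite /G !ler_norml => ? /andP[? ?] /andP[? ?] /andP[? ?].
  by apply/andP; split; lra.
have I1 : lebesgue_measure.-integrable [set r : R | 0 <= r <= t]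
    (EFin \o (fun r => transport_rate f (mu r))).
  have h r r' (a : 0 <= r <= T) (b : 0 <= r' <= T) := let: And3 x1 x2 x3 := lipQ r r' a b in x1.
  exact: (lip_on_itv_integrable (G := fun r => transport_rate f (mu r)) T0 h tT).
have I2 : lebesgue_measure.-integrable [set r : R | 0 <= r <= t]
    (EFin \o (fun r => growth_rate f (mu r))).
  have h r r' (a : 0 <= r <= T) (b : 0 <= r' <= T) := let: And3 x1 x2 x3 := lipQ r r' a b in x2.
  exact: (lip_on_itv_integrable (G := fun r => growth_rate f (mu r)) T0 h tT).
have I3 : lebesgue_measure.-integrable [set r : R | 0 <= r <= t]
    (EFin \o (fun r => source_rate f (mu r))).
  have h r r' (a : 0 <= r <= T) (b : 0 <= r' <= T) := let: And3 x1 x2 x3 := lipQ r r' a b in x3.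
  exact: (lip_on_itv_integrable (G := fun r => source_rate f (mu r)) T0 h tT).
have mI : measurable [set r : R | 0 <= r <= t].
  rewrite (_ : [set r : R | 0 <= r <= t] = `[0, t]%classic); first exact: measurable_itv.
  by apply/seteqP; split => r; rewrite /= in_itv.
rewrite -(RintegralD3 _ I1 I2 I3)//.
rewrite -(limit_init tf).
exact: (integral_of_quadratic_remainder (F := fun t => \int[mu t]_x f x) T0 key lipG tT).
Qed.

End Limit.

Lemma euler_solution : exists mu : R -> Mplus R d,
  is_solution V s c T mu0 mu /\ lipschitz_in_time T mu.
Proof.
have [mu [mb ml]] := euler_limit; exists mu.
have Hlip := limit_lip ml; split; last by exists lip_time => t t' tT tT'; rewrite -EFinM; exact: Hlip.
split=> [t tT eps eps0|f tf t tT]; last exact: (limit_weak mb ml tf tT).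
have l0 := lip_time_ge0; have l1 : 0 < lip_time + 1 by rewrite ltr_wpDl.
exists (eps / (lip_time + 1)); first by rewrite divr_gt0.
move=> t' tT'; rewrite ltr_pdivlMr// => tt; apply: le_lt_trans (Hlip _ _ tT tT') _.
rewrite lte_fin; apply: le_lt_trans tt; rewrite mulrC ler_wpM2l// lerDl//.
Qed.

End Iteration.

End Euler.

Theorem theorem2p5 (R : realType) (d : nat)
    (V : Mplus R d -> Mplus2 R d) (s : Mplus R d -> Mplus R d)
    (c : 'rV[R]_d -> Mplus R d -> R) (mu0 : Mplus R d) :
  cond_V V -> cond_S s -> cond_C c ->
  (exists r : R, supp (@eucl_dist R d) mu0 `<=` @cball0 R d r) ->
  forall T : R, 0 < T ->
  exists mu : R -> Mplus R d, is_solution V s c T mu0 mu /\ lipschitz_in_time T mu.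
Proof.
move=> [Vm [CS [CS0 Vs]] Vl] [[L sl] [rs ss]] [[Cb [Cb0 cb]] [CL [CL0 cl]]] [r1 mu0r] T T0.
(* A nonnegative radius that covers the initial support and all sources. *)
pose r0 := Num.max (Num.max r1 rs) 0.
have r00 : 0 <= r0 by rewrite le_max lexx orbT.
have rs_r0 : rs <= r0 by rewrite !le_max lexx orbT.
have mu0n : mu0 (~` @cball0 R d r0) = 0%E.
  apply: supp_cball_null => x /mu0r; rewrite /cball0 /= => /le_trans; apply.
  by rewrite !le_max lexx.
exact: (euler_solution Vm CS0 Vs Vl sl ss Cb0 cb CL0 cl T0 r00 rs_r0 mu0n).
Qed.
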